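(* Let $(\beta,\lambda,\phi)$ be a model satisfying the standing assumptions (A1)–(A7) listed in the context, and let $(x,t)\in\mathbb R_+^n\times[0,T]$. The operator $\mathcal B$ is LCP at $(x,t)$ if and only if for all directions $v\in\mathbb R^n\setminus\{0\}$ we have $$\int_0^1\Big(f_{vv}(x+\phi)+2\phi_v\cdot\nabla f_v(x+\phi)+\phi_v\,Hf(x+\phi)\,\phi_v^*+\phi_{vv}\cdot\big(\nabla f(x+\phi)-\nabla f(x)\big)\Big)\,dz\ge0$$ for all convex functions $f\in C^4_\alpha(\mathbb R_+^n)\cap C^2_{pol}(\mathbb R_+^n)$ with $f_{vv}(x)=0$. Here $\phi,\phi_v,\phi_{vv}$ are evaluated at $(x,t,z)$.
   Context: Notation: $\mathbb R_+^n=(0,\infty)^n$, $n\ge1$, $T>0$, $\alpha\in(0,1)$ is a fixed Hölder exponent. $C_\alpha$ denotes functions that are locally Hölder continuous with exponent $\alpha$ (for functions of $(x,t)$, with respect to the parabolic distance $|x-y|+|t-s|^{1/2}$). $C^{p,q}_\alpha$ denotes functions of $(x,t)$ all of whose derivatives $\partial_x^k\partial_t^l$ with $|k|+2l\le p$, $0\le l\le q$ exist and lie in $C_\alpha$; $C^p_\alpha(\mathbb R_+^n)$ is the analogous class of functions of $x$ only. $C^2_{pol}(\mathbb R_+^n)$ is the set of $C^2$ functions which together with their derivatives of order $\le2$ are bounded in absolute value by $C(1+|x|^m)$ for some constants $C,m$. For a direction $v\in\mathbb R^n\setminus\{0\}$, $\partial_v$ is the spatial directional derivative, and subscripts $v$,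 $vv$ denote $\partial_v$, $\partial_v^2$ (in particular $\phi_v=\partial_v\phi(x,t,z)$, $\phi_{vv}=\partial_v^2\phi(x,t,z)$, derivatives in $x$, regarded as row vectors). $Hf$ is the Hessian matrix of $f$; $^*$ denotes transpose. Model data: $\beta=(\beta_{ij})$ an $n\times n$-matrix valued function on $\mathbb R_+^n\times[0,T]$, $\lambda$ a deterministic function on $[0,T]$ (the jump intensity), $\phi=(\phi_1,\dots,\phi_n)$ (the jump sizes). Standing assumptions ($D>0$ a constant; for all $x,y\in\mathbb R_+^n$, $t\in[0,T]$, $z\in[0,1]$): (A1) $\beta_{ij}\in C^{2,0}_\alpha(\mathbb R_+^n\times[0,T])$ for all $i,j$. (A2) $\lambda\in C_\alpha([0,T])$. (A3) $\sum_{j=1}^n|\beta_{ij}(x,t)|^2+|\phi_i(x,t,z)|^2\le Dx_i^2$ for all $i$. (A4) $|\beta(x,t)-\beta(y,t)|+|\phi(x,t,z)-\phi(y,t,z)|\le D|x-y|$. (A5) $\beta(x,t)$ is non-singular for all $(x,t)$. (A6) $\phi:\mathbb R_+^n\times[0,T]\times[0,1]\to\mathbb R^n$ is measurable, $\phi_i(\cdot,\cdot,z)\in C^{2,0}_\alpha(\mathbb R_+^n\times[0,T])$ with (local) Hölder norms bounded uniformly in $z$; moreover, for all $x,t$, $\phi(x,t,z)\ne0$ for almost all $z$. (A7) There is $\gamma>-1$ such that $\phi_i(x,t,z)>\gamma x_i$ for all $i$. The operator $\mathcal B$ acts on functions $f$ of $x$ by $$\mathcal Bf(x,t)=\lambda(t)\int_0^1\big(f(x+\phi(x,t,z))-f(x)-\phi(x,t,z)\cdot\nabla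 f(x)\big)\,dz.$$ $\mathcal B$ is locally convexity preserving (LCP) at $(x,t)\in\mathbb R_+^n\times[0,T]$ if for every $v\in\mathbb R^n\setminus\{0\}$ we have $\partial_v^2(\mathcal Bf)(x,t)\ge0$ for all convex $f\in C^4_\alpha(\mathbb R_+^n)\cap C^2_{pol}(\mathbb R_+^n)$ with $f_{vv}(x)=0$.
   Formalization: The formal theorem assumes that the jump intensity is strictly positive at the given time, λ(t)>0; without this the equivalence fails, since λ(t)=0 makes LCP at (x,t) trivially true while the integral condition can fail. *)

(* Defs.v *)
From HB Require Import structures.
From mathcomp Require Import all_boot all_order all_algebra.
From mathcomp Require Import all_classical all_reals all_analysis.

Set Implicit Arguments.
Unset Strict Implicit.
Unset Printing Implicit Defensive.

Import Order.TTheory GRing.Theory Num.Theory.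
Import numFieldNormedType.Exports.

Local Open Scope classical_set_scope.
Local Open Scope ring_scope.

(* The norm carried by matrices in the library is the sup norm; this is the
   Euclidean norm of a row vector and the Frobenius norm of a matrix. *)
Definition enorm (R : realType) (m n : nat) (A : 'M[R]_(m, n)) : R :=
  Num.sqrt (\sum_(i < m) \sum_(j < n) A i j ^+ 2).

Definition dotv (R : realType) (n : nat) (u v : 'rV[R]_n) : R :=
  \sum_(i < n) u 0 i * v 0 i.

Definition orthant (R : realType) (n : nat) : set 'rV[R]_n :=
  [set x | forall i, 0 < x 0 i].

(* Functions of [x] are total on ['rV[R]_n], but only their values on the
   orthant are ever constrained or used. *)

Definition grad (R : realType) (n : nat) (f : 'rV[R]_n -> R) (x : 'rV[R]_n) :
    'rV[R]_n :=
  \row_(i < n) 'D_(delta_mx 0 i) f x.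

Definition hess (R : realType) (n : nat) (f : 'rV[R]_n -> R) (x : 'rV[R]_n) :
    'M[R]_n :=
  \matrix_(i < n, j < n) 'D_(delta_mx 0 i) ('D_(delta_mx 0 j) f) x.

(* [iter_partial [:: i1; ...; ik] f] is the derivative of order [k] of [f] in
   the coordinate directions [ik], ..., [i1], taken in that order. *)
Definition iter_partial (R : realType) (n : nat) (s : seq 'I_n)
    (f : 'rV[R]_n -> R) : 'rV[R]_n -> R :=
  foldr (fun i g => 'D_(delta_mx 0 i) g) f s.

Definition has_partials (R : realType) (n p : nat) (f : 'rV[R]_n -> R) : Prop :=
  forall (s : seq 'I_n) (i : 'I_n), (size s < p)%N ->
  forall x, orthant x -> derivable (iter_partial s f) x (delta_mx 0 i).

(* [C] bounds both the sup norm on [K] and the [alpha]-Hoelder seminorm on [K]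
   with respect to the distance [dist]. *)
Definition holder_bound (R : realType) (X : Type) (alpha : R)
    (dist : X -> X -> R) (K : set X) (g : X -> R) (C : R) : Prop :=
  (forall p, K p -> `|g p| <= C) /\
  (forall p q, K p -> K q -> `|g p - g q| <= C * (dist p q `^ alpha)).

Definition locally_holder (R : realType) (X : topologicalType) (alpha : R)
    (dist : X -> X -> R) (D : set X) (g : X -> R) : Prop :=
  forall K : set X, compact K -> K `<=` D ->
  exists C : R, holder_bound alpha dist K g C.

Definition edist (R : realType) (n : nat) (x y : 'rV[R]_n) : R := enorm (x - y).

Definition tdist (R : realType) (s t : R) : R := `|s - t|.

Definition pdist (R : realType) (n : nat) (p q : 'rV[R]_n * R) : R :=
  enorm (p.1 - q.1) + Num.sqrt `|p.2 - q.2|.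

Definition cylinder (R : realType) (n : nat) (T : R) : set ('rV[R]_n * R) :=
  [set p | orthant p.1 /\ 0 <= p.2 <= T].

(* C^p_alpha on the orthant *)
Definition C_holder (R : realType) (n p : nat) (alpha : R)
    (f : 'rV[R]_n -> R) : Prop :=
  has_partials p f /\
  forall s : seq 'I_n, (size s <= p)%N ->
    locally_holder alpha (@edist R n) (@orthant R n) (iter_partial s f).

(* C^{p,0}_alpha on the orthant times [0, T]: only derivatives in [x] occur. *)
Definition C_holder_par (R : realType) (n p : nat) (alpha T : R)
    (g : 'rV[R]_n -> R -> R) : Prop :=
  (forall t : R, 0 <= t <= T -> has_partials p (g^~ t)) /\
  forall s : seq 'I_n, (size s <= p)%N ->
    locally_holder alpha (@pdist R n) (@cylinder R n T)
      (fun q => iter_partial s (g^~ q.2) q.1).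

(* The C^{p,0}_alpha norms of [g z] on any compact set are bounded uniformly in
   [z] in [0, 1]. *)
Definition unif_holder_norms (R : realType) (n p : nat) (alpha T : R)
    (g : R -> 'rV[R]_n -> R -> R) : Prop :=
  forall K : set ('rV[R]_n * R), compact K -> K `<=` @cylinder R n T ->
  exists C : R, forall z : R, 0 <= z <= 1 ->
  forall s : seq 'I_n, (size s <= p)%N ->
    holder_bound alpha (@pdist R n) K
      (fun q => iter_partial s ((g z)^~ q.2) q.1) C.

(* C^2_pol on the orthant *)
Definition C2_pol (R : realType) (n : nat) (f : 'rV[R]_n -> R) : Prop :=
  [/\ has_partials 2 f,
      (forall s : seq 'I_n, (size s <= 2)%N ->
       forall x, orthant x -> {for x, continuous (iter_partial s f)}) &
      exists (C : R) (m : nat), forall s : seq 'I_n, (size s <= 2)%N ->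
      forall x, orthant x -> `|iter_partial s f x| <= C * (1 + enorm x ^+ m)].

Record model_assumptions (R : realType) (n : nat) (alpha T : R)
    (beta : 'rV[R]_n -> R -> 'M[R]_n) (lam : R -> R)
    (phi : 'rV[R]_n -> R -> R -> 'rV[R]_n) : Prop := ModelAssumptions {
  beta_holder : forall i j, C_holder_par 2 alpha T (fun x t => beta x t i j);
  lam_holder : locally_holder alpha (@tdist R) `[0, T] lam;
  growth_lipschitz : exists2 D : R, 0 < D &
    (forall (x : 'rV[R]_n) (t z : R) (i : 'I_n),
      orthant x -> 0 <= t <= T -> 0 <= z <= 1 ->
      \sum_(j < n) `|beta x t i j| ^+ 2 + `|phi x t z 0 i| ^+ 2
        <= D * x 0 i ^+ 2) /\
    (forall (x y : 'rV[R]_n) (t z : R),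
      orthant x -> orthant y -> 0 <= t <= T -> 0 <= z <= 1 ->
      enorm (beta x t - beta y t) + enorm (phi x t z - phi y t z)
        <= D * enorm (x - y));
  beta_nonsingular : forall (x : 'rV[R]_n) (t : R), orthant x -> 0 <= t <= T ->
    beta x t \in unitmx;
  phi_measurable :
    @measurable_fun _ _
      (g_sigma_algebraType (@open ('rV[R]_n * R * R)%type))
      (g_sigma_algebraType (@open 'rV[R]_n))
      [set p | [/\ orthant p.1.1, 0 <= p.1.2 <= T & 0 <= p.2 <= 1]]
      (fun p => phi p.1.1 p.1.2 p.2);
  phi_holder : forall (i : 'I_n) (z : R), 0 <= z <= 1 ->
    C_holder_par 2 alpha T (fun x t => phi x t z 0 i);
  phi_holder_unif : forall i,
    unif_holder_norms 2 alpha T (fun z x t => phi x t z 0 i);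
  phi_neq0 : forall (x : 'rV[R]_n) (t : R), orthant x -> 0 <= t <= T ->
    {ae lebesgue_measure, forall z : R, 0 <= z <= 1 -> phi x t z != 0};
  phi_lower : exists2 gamma : R, -1 < gamma &
    forall (x : 'rV[R]_n) (t z : R) (i : 'I_n),
      orthant x -> 0 <= t <= T -> 0 <= z <= 1 ->
      gamma * x 0 i < phi x t z 0 i
}.

Definition jump_op (R : realType) (n : nat) (lam : R -> R)
    (phi : 'rV[R]_n -> R -> R -> 'rV[R]_n) (f : 'rV[R]_n -> R)
    (x : 'rV[R]_n) (t : R) : R :=
  lam t * \int[lebesgue_measure]_(z in `[0, 1])
    (f (x + phi x t z) - f x - dotv (phi x t z) (grad f x)).

Definition convex_test (R : realType) (n : nat) (alpha : R)
    (f : 'rV[R]_n -> R) : Prop :=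
  [/\ convex_function (@orthant R n) f, C_holder 4 alpha f & C2_pol f].

Definition LCP (R : realType) (n : nat) (alpha : R) (lam : R -> R)
    (phi : 'rV[R]_n -> R -> R -> 'rV[R]_n) (x : 'rV[R]_n) (t : R) : Prop :=
  forall v : 'rV[R]_n, v != 0 ->
  forall f : 'rV[R]_n -> R, convex_test alpha f -> 'D_v ('D_v f) x = 0 ->
  0 <= 'D_v ('D_v (fun y => jump_op lam phi f y t)) x.

(* Main.v *)
(** For every direction [v] and every convex test function [f] with
    [f_vv(x) = 0], the two quantities whose signs are compared are equal up to
    the factor [lam t > 0].  Differentiating twice under the integral along the
    line [x + h v] gives the integrand of the theorem together with the extra
    terms [f_vv(x)], [phi_v . (grad f)_v(x)] and [phi . (grad f)_vv(x)].  These
    vanish: [Hf(x)] is positive semidefinite and its quadratic form is zero at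
    [v], so [Hf(x) v = 0]; and [f_vv >= 0] has a minimum at [x], so its gradient
    vanishes there.  Domination is free because the
    points [y + phi(y, t, z)], for [y] near [x] and [z] in [0, 1], stay in a
    compact box of the orthant: the lower bound on [phi] keeps them away from
    the boundary. *)
Require Import Defs.
From HB Require Import structures.
From mathcomp Require Import all_boot all_order all_algebra.
From mathcomp Require Import all_classical all_reals all_analysis.
From mathcomp Require Import ring lra.

Import Order.TTheory GRing.Theory Num.Theory.
Import numFieldNormedType.Exports.

Local Open Scope classical_set_scope.
Local Open Scope ring_scope.

Set Implicit Arguments.
Unset Strict Implicit.

(** * Mean values along lines *)

(** Both sides have literally the same difference quotient. This passage, at every point of the line
    and not only at [h = 0], makes one-variable theorems available for directional derivatives. *)
Lemma is_derive_line (R : realType) (V W : normedModType R) (f : V -> W)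
    (y v : V) (h : R) (df : W) :
  is_derive h (1 : R) (fun u : R => f (y + u *: v)) df <->
  is_derive (y + h *: v) v f df.
Proof.
have eqd : (fun u : R => u^-1 *: (((fun u => f (y + u *: v)) \o shift h) (u *: (1 : R))
      - f (y + h *: v))) =
    (fun u : R => u^-1 *: ((f \o shift (y + h *: v)) (u *: v) - f (y + h *: v))).
  apply/funext => u /=; congr (_ *: (f _ - _)).
  by rewrite /= [u *: (1 : R)]mulr1 scalerDl addrCA.
split=> -[dh <-]; split.
- by move: dh; rewrite /derivable eqd.
- by rewrite /derive eqd.
- by move: dh; rewrite /derivable eqd.
- by rewrite /derive eqd.
Qed.

(** Allowing [s] of either sign, with [|u| <= |s|] instead of an interval, spares later uses a case
    distinction on the sign of a coordinate increment. *)
Lemma mvt_line (R : realType) (V : normedModType R) (f : V -> R) (y w : V)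
    (s : R) :
  (forall u, `|u| <= `|s| -> derivable f (y + u *: w) w) ->
  exists2 u, `|u| <= `|s| & f (y + s *: w) - f y = s * 'D_w f (y + u *: w).
Proof.
move=> df.
have dg u : `|u| <= `|s| ->
    is_derive u (1 : R) (fun u : R => f (y + u *: w)) ('D_w f (y + u *: w)).
  by move=> us; apply/is_derive_line; apply: derivableP; exact: df.
have cg a b : (forall u, u \in `[a, b] -> `|u| <= `|s|) ->
    {within `[a, b], continuous (fun u : R => f (y + u *: w))}.
  move=> ab; apply: derivable_within_continuous => u uab.
  by have [] := dg _ (ab _ uab).
have [s0|s0] := leP 0 s.
  have sub u : u \in `[0, s] -> `|u| <= `|s|.
    by rewrite in_itv/= => /andP[u0 us]; rewrite !ger0_norm.
  have [||u us] := @MVT_segment R (fun u => f (y + u *: w))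
    (fun u => 'D_w f (y + u *: w)) 0 s s0.
  - by move=> u us; apply/dg/sub; exact: subset_itv_oo_cc us.
  - exact: cg.
  rewrite scale0r addr0 subr0 => fE.
  by exists u; [exact: sub|rewrite fE mulrC].
have sub u : u \in `[s, 0] -> `|u| <= `|s|.
  by rewrite in_itv/= => /andP[us u0]; rewrite !ler0_norm ?lerN2// ltW.
have [||u us] := @MVT_segment R (fun u => f (y + u *: w))
    (fun u => 'D_w f (y + u *: w)) s 0 (ltW s0).
- by move=> u us; apply/dg/sub; exact: subset_itv_oo_cc us.
- exact: cg.
rewrite scale0r addr0 sub0r => fE.
by exists u; [exact: sub|rewrite -opprB fE mulrN mulrC opprK].
Qed.

(** Two mean value steps: the increment [g] of [f] along [w] is taken along [v], which leaves an
    increment of ['D_v f] along [w]. *)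
Lemma second_difference (R : realType) (V : normedModType R) (f : V -> R)
    (y v w : V) (s : R) :
  (forall a b, `|a| <= `|s| -> `|b| <= `|s| ->
    derivable f (y + a *: v + b *: w) v /\
    derivable ('D_v f) (y + a *: v + b *: w) w) ->
  exists a b, [/\ `|a| <= `|s|, `|b| <= `|s| &
    f (y + s *: v + s *: w) - f (y + s *: v) - f (y + s *: w) + f y =
      s ^+ 2 * 'D_w ('D_v f) (y + a *: v + b *: w)].
Proof.
move=> df.
pose g := fun x => f (x + s *: w) - f x.
have dg a : `|a| <= `|s| -> is_derive (y + a *: v) v g
    ('D_v f (y + a *: v + s *: w) - 'D_v f (y + a *: v)).
  move=> sa; apply: is_deriveB.
    apply/is_derive_line.
    have -> : (fun u : R => f (y + u *: v + s *: w)) =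
        (fun u : R => f (y + s *: w + u *: v)).
      by apply/funext => u; rewrite addrAC.
    rewrite addrAC; apply/is_derive_line.
    by rewrite addrAC; apply: derivableP; apply: (df _ _ _ _).1.
  apply: derivableP; have := (df a 0 sa _).1.
  by rewrite scale0r addr0; apply; rewrite normr0.
have [|a sa ga] := @mvt_line _ _ g y v s; first by move=> a /dg[].
have [|b sb gb] := @mvt_line _ _ ('D_v f) (y + a *: v) w s.
  by move=> b sb; apply: (df _ _ _ _).2.
exists a, b; split => //.
rewrite expr2 -mulrA -gb; have [_ <-] := dg _ sa.
by rewrite -ga /g opprB addrA addrAC.
Qed.

(** * Functions of class C^k on the orthant *)

Lemma near_orthant (R : realType) (n : nat) (x : 'rV[R]_n) :
  orthant x -> \forall y \near x, orthant y.
Proof.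
move=> x0; apply: (@filter_forall 'rV[R]_n 'I_n
  (fun i => [set y | 0 < y 0 i]) (nbhs x) _) => i.
have /cvgr_gt := @coord_continuous R 1 n 0 i x.
by apply; exact: x0.
Qed.

Definition C1 (R : realType) (n : nat) (f : 'rV[R]_n -> R) : Prop :=
  forall i x, orthant x ->
    derivable f x (delta_mx 0 i) /\ {for x, continuous ('D_(delta_mx 0 i) f)}.

(* [Ck 0 f] says nothing about [f], not even that it is continuous. *)
Fixpoint Ck (R : realType) (n k : nat) (f : 'rV[R]_n -> R) : Prop :=
  if k is k'.+1 then C1 f /\ forall i, Ck k' ('D_(delta_mx 0 i) f) else True.

(** The points [truncv k h] are the corners of a staircase from 0 to [h] whose legs are parallel to
    the coordinate axes; increments of a function are telescoped along it. *)
Definition truncv (R : realType) (n k : nat) (h : 'rV[R]_n) : 'rV[R]_n :=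
  \row_i (if (i < k)%N then h 0 i else 0).

Lemma truncvS (R : realType) (n : nat) (i : 'I_n) (h : 'rV[R]_n) :
  truncv i.+1 h = truncv i h + h 0 i *: delta_mx 0 i.
Proof.
apply/rowP => j; rewrite !mxE eqxx/= ltnS leq_eqVlt (inj_eq val_inj).
by have [->|_] := eqVneq j i; rewrite ?ltnn ?mulr1 ?mulr0 ?add0r ?addr0.
Qed.

Lemma le_norm_coord (R : realType) (n : nat) (h : 'rV[R]_n) (e : R) :
  0 <= e -> (`|h| <= e) = [forall i, `|h 0 i| <= e].
Proof.
move=> e0; rewrite [`|h|]/Num.Def.normr/= mx_normrE.
apply/bigmax_leP/forallP => [[_ he] i|he]; first exact: (he (0, i)).
by split => // -[i j] _; rewrite ord1.
Qed.

Lemma norm_coord (R : realType) (n : nat) (h : 'rV[R]_n) i : `|h 0 i| <= `|h|.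
Proof.
by have := lexx `|h|; rewrite {1}le_norm_coord// => /forallP.
Qed.

(** Keeps every leg of the staircase inside the sup-norm ball of radius [|h|], where the partial
    derivatives are under control. *)
Lemma norm_truncv (R : realType) (n k : nat) (h : 'rV[R]_n) (i : 'I_n) (u : R) :
  `|u| <= `|h 0 i| -> `|truncv i h + u *: delta_mx 0 i| <= `|h|.
Proof.
move=> uh; rewrite le_norm_coord//; apply/forallP => j; rewrite !mxE eqxx/=.
have [->|_] := eqVneq j i; rewrite ?ltnn ?mulr1 ?mulr0 ?add0r ?addr0.
  by rewrite (le_trans uh) ?norm_coord.
by case: ifPn => _; rewrite ?normr0 ?norm_coord.
Qed.

(** The candidate for the differential of a function with partial derivatives [c]; it is registered
    as a linear map below so that uniqueness of the differential applies to it. *)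
Definition coord_form (R : realType) (n : nat) (c : 'I_n -> R) (h : 'rV[R]_n) : R :=
  \sum_i h 0 i * c i.

Lemma coord_form_linear (R : realType) (n : nat) (c : 'I_n -> R) :
  linear (coord_form c : 'rV[R]_n -> R).
Proof.
move=> a u v; rewrite /coord_form scaler_sumr -big_split/=.
by apply: eq_bigr => i _; rewrite !mxE mulrDl -mulrA.
Qed.

HB.instance Definition _ (R : realType) (n : nat) (c : 'I_n -> R) :=
  GRing.isLinear.Build R 'rV[R]_n R *:%R (coord_form c) (coord_form_linear c).

Lemma coord_form_continuous (R : realType) (n : nat) (c : 'I_n -> R) :
  continuous (coord_form c : 'rV[R]_n -> R).
Proof.
apply: continuous_big => [|i _ x]; first exact: add_continuous.
by apply: continuousM; [exact: coord_continuous|exact: cst_continuous].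
Qed.

(** Continuous partial derivatives yield a total differential: the increment is telescoped along the
    staircase, and the mean value theorem on each leg produces a partial derivative close to its
    value at [x]. *)
Lemma C1_diff (R : realType) (n : nat) (f : 'rV[R]_n -> R) (x : 'rV[R]_n) :
  C1 f -> orthant x ->
  is_diff x f (coord_form (fun i => 'D_(delta_mx 0 i) f x)).
Proof.
move=> f1 x0.
set L : 'rV[R]_n -> R^o := coord_form _.
have fE : (f : 'rV[R]_n -> R^o) \o shift x = cst (f x : R^o) + L +o_ (0 : 'rV[R]_n) id.
  apply: (eqaddoP _ _ _ _).2 => e e0 /=.
  (* Each of the [n] legs gets the share [e / (n + 1)] of the error; the total stays below [e], and
     the denominator is positive even for [n = 0]. *)
  have e'0 : 0 < e / n.+1%:R by rewrite divr_gt0.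
  have near_df : nbhs x [set y | forall i,
      `|'D_(delta_mx 0 i) f x - 'D_(delta_mx 0 i) f y| <= e / n.+1%:R].
    apply: (@filter_forall 'rV[R]_n 'I_n (fun i => [set y |
      `|'D_(delta_mx 0 i) f x - 'D_(delta_mx 0 i) f y| <= e / n.+1%:R]) (nbhs x) _) => i.
    by have [_ /cvgr_dist_le] := f1 i x x0; apply.
  have /(nbhs_ballP x)[d /= d0 fd] :
      nbhs x [set y | orthant y /\ forall i,
        `|'D_(delta_mx 0 i) f x - 'D_(delta_mx 0 i) f y| <= e / n.+1%:R].
    exact: filterI (near_orthant x0) near_df.
  apply/nbhs_ballP; exists d => //= h; rewrite -ball_normE/= sub0r normrN => hd.
  rewrite fctE/= /L.
  have fxd k : `|k| <= `|h| -> ball x d (x + k).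
    by move=> kh; rewrite -ball_normE/= opprD addNKr normrN (le_lt_trans kh).
  have step (i : 'I_n) : `|f (x + truncv i.+1 h) - f (x + truncv i h)
      - h 0 i * 'D_(delta_mx 0 i) f x| <= `|h| * (e / n.+1%:R).
    have [u ui|u ui] := @mvt_line _ _ f (x + truncv i h) (delta_mx 0 i) (h 0 i).
      rewrite -addrA.
      have [xo _] := fd _ (fxd _ (@norm_truncv _ _ 0%N _ _ _ ui)).
      by have [] := f1 i _ xo.
    rewrite truncvS addrA => ->.
    rewrite -mulrBr normrM ler_pM ?norm_coord//.
    rewrite -addrA distrC.
    by have [_ ] := fd _ (fxd _ (@norm_truncv _ _ 0%N _ _ _ ui)); apply.
  rewrite -[(- (_ + _)) h]/(- (f x + coord_form (fun i => 'D_(delta_mx 0 i) f x) h)).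
  rewrite opprD addrA addrC [h + x]addrC.
  have -> : f (x + h) - f x = \sum_(i < n) (f (x + truncv i.+1 h) - f (x + truncv i h)).
    rewrite -(big_mkord predT (fun i => f (x + truncv i.+1 h) - f (x + truncv i h))).
    rewrite telescope_sumr//; congr (f (_ + _) - f _).
      by apply/rowP => i; rewrite mxE ltn_ord.
    rewrite -[LHS]addr0; congr (_ + _).
    by apply/rowP => i; rewrite !mxE.
  rewrite addrC /coord_form -sumrB.
  rewrite (le_trans (ler_norm_sum _ _ _))//.
  rewrite (le_trans (ler_sum _ (fun i _ => step i)))//.
  rewrite sumr_const card_ord [leRHS]mulrC -[leLHS]mulr_natr -mulrA ler_wpM2l//.
  by rewrite -mulrA ger_pMr// ler_pdivrMl// mulr1 ler_nat.
have dfE := diff_unique (@coord_form_continuous R n _ : continuous L) fE.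
split => //; apply/diff_locallyP; rewrite dfE; split => //.
exact: coord_form_continuous.
Qed.

Lemma C1_derive (R : realType) (n : nat) (f : 'rV[R]_n -> R) (x v : 'rV[R]_n) :
  C1 f -> orthant x ->
  is_derive x v f (\sum_i v 0 i * 'D_(delta_mx 0 i) f x).
Proof.
move=> f1 x0; have [df dfE] := C1_diff f1 x0.
by split; [exact: diff_derivable|rewrite deriveE// dfE].
Qed.

(** The path is differentiated coordinate by coordinate because the smoothness of the jump sizes is
    given for each component separately. *)
Lemma C1_chain (R : realType) (n : nat) (f : 'rV[R]_n -> R) (p : R -> 'rV[R]_n)
    (h : R) (q : 'I_n -> R) :
  C1 f -> orthant (p h) ->
  (forall i, is_derive h (1 : R) (fun u => p u 0 i) (q i)) ->
  is_derive h (1 : R) (f \o p) (\sum_i q i * 'D_(delta_mx 0 i) f (p h)).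
Proof.
move=> f1 ph dp; have [df dfE] := C1_diff f1 ph.
have dp' : derivable p h (1 : R).
  by apply/derivable_mxP => i j; rewrite ord1; case: (dp j).
have dp'' : differentiable p h by exact/derivable1_diffP.
split; first exact/derivable1_diffP/differentiable_comp.
rewrite deriveE; last exact: differentiable_comp.
rewrite diff_comp//= dfE -deriveE// derive_mx//.
by apply: eq_bigr => i _; rewrite mxE; have [_ ->] := dp i.
Qed.

Lemma C1_continuous (R : realType) (n : nat) (f : 'rV[R]_n -> R) (x : 'rV[R]_n) :
  C1 f -> orthant x -> {for x, continuous f}.
Proof. by move=> f1 x0; have [/differentiable_continuous] := C1_diff f1 x0. Qed.

Section eq_orthant.
Context (R : realType) (n : nat) (f g : 'rV[R]_n -> R).
Hypothesis fg : forall x, orthant x -> f x = g x.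

(** Values off the orthant are arbitrary, but the orthant is open, so agreement on it is agreement
    near each of its points and carries over to derivatives and continuity. *)
Lemma eq_orthant_near x : orthant x -> \near x, f x = g x.
Proof. by move=> x0; apply: filterS (near_orthant x0) => y; exact: fg. Qed.

Lemma eq_orthant_derive v x : orthant x -> 'D_v f x = 'D_v g x.
Proof. by move=> x0; apply: near_eq_derive; exact: eq_orthant_near. Qed.

Lemma eq_orthant_continuous x :
  orthant x -> {for x, continuous f} -> {for x, continuous g}.
Proof.
move=> x0 fx; rewrite /prop_for /continuous_at -fg//.
apply: cvg_trans fx; apply: (near_eq_cvg (F := nbhs x)).
by apply: filterS (eq_orthant_near x0) => y /esym.
Qed.

End eq_orthant.

Lemma C1_eq (R : realType) (n : nat) (f g : 'rV[R]_n -> R) :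
  (forall x, orthant x -> f x = g x) -> C1 f -> C1 g.
Proof.
move=> fg f1 i x x0; have [df cf] := f1 i x x0; split.
  by apply: near_eq_derivable df; exact: (eq_orthant_near fg).
apply: eq_orthant_continuous cf => // y y0.
exact: (eq_orthant_derive fg).
Qed.

Lemma Ck_eq (R : realType) (n k : nat) (f g : 'rV[R]_n -> R) :
  (forall x, orthant x -> f x = g x) -> Ck k f -> Ck k g.
Proof.
elim: k f g => // k IH f g fg [f1 fk]; split; first exact: C1_eq f1.
by move=> i; apply: IH (fk i) => x; exact: (eq_orthant_derive fg).
Qed.

Lemma derive_lin (R : realType) (n : nat) (a : R) (f g : 'rV[R]_n -> R) v x :
  derivable f x v -> derivable g x v ->
  is_derive x v (fun y => a * f y + g y) (a * 'D_v f x + 'D_v g x).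
Proof.
move=> df dg.
exact: is_deriveD (is_deriveZ a (derivableP df)) (derivableP dg).
Qed.

Lemma Ck_lin (R : realType) (n k : nat) (a : R) (f g : 'rV[R]_n -> R) :
  Ck k f -> Ck k g -> Ck k (fun x => a * f x + g x).
Proof.
elim: k f g => // k IH f g [f1 fk] [g1 gk]; split; last first.
  move=> i; apply: Ck_eq (IH _ _ (fk i) (gk i)) => x x0.
  have [df _] := f1 i x x0; have [dg _] := g1 i x x0.
  by have [_ ->] := derive_lin a df dg.
move=> i x x0.
have [df cf] := f1 i x x0; have [dg cg] := g1 i x x0; split.
  by have [] := derive_lin a df dg.
apply: (@eq_orthant_continuous _ _
    (fun y => a * 'D_(delta_mx 0 i) f y + 'D_(delta_mx 0 i) g y)) => //.
  move=> y y0; have [df' _] := f1 i y y0; have [dg' _] := g1 i y y0.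
  by have [_ ->] := derive_lin a df' dg'.
apply: (@continuousD _ _ _ (fun y => a * 'D_(delta_mx 0 i) f y)); last exact: cg.
by apply: continuousM; [exact: cst_continuous|exact: cf].
Qed.

Lemma Ck_cst (R : realType) (n k : nat) (c : R) : Ck k (fun _ : 'rV[R]_n => c).
Proof.
elim: k c => // k IH c.
have D0 i : 'D_(delta_mx 0 i) (fun _ : 'rV[R]_n => c) = fun=> 0.
  by apply/funext => x; exact: derive_cst.
split=> [i x _|i]; rewrite D0//.
by split; [exact: derivable_cst|exact: cst_continuous].
Qed.

Lemma Ck_sum (R : realType) (n k : nat) (I : Type) (r : seq I) (c : I -> R)
    (F : I -> 'rV[R]_n -> R) :
  (forall i, Ck k (F i)) -> Ck k (fun x => \sum_(i <- r) c i * F i x).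
Proof.
move=> Fk; elim: r => [|i r IH].
  by apply: Ck_eq (@Ck_cst R n k 0) => x _; rewrite big_nil.
by apply: Ck_eq (Ck_lin (c i) (Fk i) IH) => x _; rewrite big_cons.
Qed.

(** [Ck] recurses on coordinate directions only; a general directional derivative is a constant
    combination of those. *)
Lemma Ck_derive (R : realType) (n k : nat) (f : 'rV[R]_n -> R) v :
  Ck k.+1 f -> Ck k ('D_v f).
Proof.
move=> [f1 fk]; apply: Ck_eq (Ck_sum (index_enum 'I_n) (fun i => v 0 i) fk) => x x0.
by have [_ <-] := C1_derive v f1 x0.
Qed.

Lemma CkW (R : realType) (n k : nat) (f : 'rV[R]_n -> R) : Ck k.+1 f -> Ck k f.
Proof.
elim: k f => // k IH f [f1 fk]; split => // i; exact/IH/fk.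
Qed.

Lemma derive_dirD (R : realType) (n : nat) (f : 'rV[R]_n -> R) (x v w : 'rV[R]_n)
    (s : R) :
  C1 f -> orthant x -> 'D_(v + s *: w) f x = 'D_v f x + s * 'D_w f x.
Proof.
move=> f1 x0; have [_ ->] := C1_derive (v + s *: w) f1 x0.
have [_ ->] := C1_derive v f1 x0; have [_ ->] := C1_derive w f1 x0.
rewrite mulr_sumr -big_split/=; apply: eq_bigr => i _.
by rewrite !mxE mulrDl mulrA.
Qed.

Lemma continuous_at_sum (R : realType) (T : topologicalType) (I : Type)
    (r : seq I) (F : I -> T -> R) (x : T) :
  (forall i, {for x, continuous (F i)}) ->
  {for x, continuous (fun y => \sum_(i <- r) F i y)}.
Proof.
move=> cF.
apply: (@cvg_big _ _ _ _ predT _ _ (nbhs x) r F (F^~ x)) => [|i _].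
  exact: add_continuous.
exact: cF.
Qed.

Lemma C1_derive_continuous (R : realType) (n : nat) (f : 'rV[R]_n -> R)
    (x v : 'rV[R]_n) :
  C1 f -> orthant x -> {for x, continuous ('D_v f)}.
Proof.
move=> f1 x0.
apply: (@eq_orthant_continuous _ _
    (fun x => \sum_i v 0 i * 'D_(delta_mx 0 i) f x)) => //.
  by move=> y y0; have [_ <-] := C1_derive v f1 y0.
apply: continuous_at_sum => i.
by apply: continuousM; [exact: cst_continuous|have [] := f1 i x x0].
Qed.

(** * Second differences and symmetry of mixed derivatives *)

(** Provides small parallelograms around [x]; with [b = 0] it also provides segments. *)
Lemma orthant_line_near (R : realType) (n : nat) (x v w : 'rV[R]_n) (P : set 'rV[R]_n) :
  nbhs x P -> exists2 d : R, 0 < d &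
    forall a b : R, `|a| <= d -> `|b| <= d -> P (x + a *: v + b *: w).
Proof.
move=> /nbhs_ballP[e /= e0 eP].
(* With this size [|a v + b w| <= e / 2 < e]; the summand 1 keeps the denominator positive when [v]
   and [w] vanish. *)
exists (e / 2 / (1 + `|v| + `|w|)) => [|a b ad bd].
  by rewrite !divr_gt0// -addrA ltr_pwDl// addr_ge0.
apply: eP; rewrite -ball_normE/= -addrA opprD addNKr normrN.
rewrite (le_lt_trans (ler_normD _ _))// !normrZ.
have N0 : 0 < 1 + `|v| + `|w| by rewrite -addrA ltr_pwDl// addr_ge0.
rewrite (@le_lt_trans _ _ (e / 2 / (1 + `|v| + `|w|) * (1 + `|v| + `|w|)))//.
  rewrite mulrDr mulrDr mulr1 -addrA.
  rewrite (le_trans (lerD (ler_wpM2r _ ad) (ler_wpM2r _ bd)))// lerDr.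
  by rewrite !divr_ge0// ltW.
by rewrite divfK ?gt_eqF// ltr_pdivrMr// ltr_pMr// ltr1n.
Qed.

(* The limit is symmetric in [v] and [w]: this gives Schwarz's theorem, and for
   [v = w] the sign of the second derivative of a convex function. *)
Lemma second_difference_lim (R : realType) (n : nat) (f : 'rV[R]_n -> R)
    (x v w : 'rV[R]_n) (e : R) :
  Ck 2 f -> orthant x -> 0 < e -> exists2 d : R, 0 < d &
  forall s, 0 < s <= d ->
  `|(f (x + s *: v + s *: w) - f (x + s *: v) - f (x + s *: w) + f x) / s ^+ 2
    - 'D_w ('D_v f) x| <= e.
Proof.
move=> f2 x0 e0.
have fv1 : C1 ('D_v f) by have [] := Ck_derive v f2.
have cf : nbhs x [set y | `|'D_w ('D_v f) x - 'D_w ('D_v f) y| <= e].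
  by have /cvgr_dist_le := C1_derive_continuous (v := w) fv1 x0; apply.
have [d d0 dP] := @orthant_line_near R n x v w _ (filterI (near_orthant x0) cf).
exists d => // s /andP[s0 sd].
have sd' : `|s| <= d by rewrite gtr0_norm.
have [|a [b [] /le_trans/(_ sd') ad /le_trans/(_ sd') bd ->]] :=
    @second_difference R _ f x v w s.
  move=> a b /le_trans/(_ sd') ad /le_trans/(_ sd') bd.
  have [xo _] := dP a b ad bd; split.
    by have [] := C1_derive v f2.1 xo.
  by have [] := C1_derive w fv1 xo.
rewrite mulrAC divff ?expf_neq0 ?gt_eqF// mul1r distrC.
by have [_] := dP a b ad bd.
Qed.

Lemma schwarz (R : realType) (n : nat) (f : 'rV[R]_n -> R) (x v w : 'rV[R]_n) :
  Ck 2 f -> orthant x -> 'D_w ('D_v f) x = 'D_v ('D_w f) x.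
Proof.
move=> f2 x0; apply/eqP; rewrite -subr_eq0 -normr_le0; apply/ler_addgt0Pl => e e0.
rewrite addr0.
have e20 : 0 < e / 2 by rewrite divr_gt0.
have [d d0 dP] := second_difference_lim v w f2 x0 e20.
have [d' d'0 dP'] := second_difference_lim w v f2 x0 e20.
(* At a common step size the two quotients coincide, so both mixed derivatives lie within [e / 2] of
   the same number. *)
pose s := Num.min d d'.
have s0 : 0 < s by rewrite lt_min d0.
have := dP s; have := dP' s.
rewrite s0 /s ge_min lexx ge_min lexx orbT/= -/s => /(_ isT) + /(_ isT).
rewrite [x + s *: w + _]addrAC addrAC [f _ - f _ - f (x + s *: v)]addrAC.
move: ('D_w ('D_v f) x) ('D_v ('D_w f) x) => A B.
set q := (_ + f x) / _ => H1 H2.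
by move: H1 H2; rewrite !ler_norml => /andP[? ?] /andP[? ?]; apply/andP; split; lra.
Qed.

(** * Convexity and null directions *)

Lemma convex_derive2_ge0 (R : realType) (n : nat) (f : 'rV[R]_n -> R)
    (x v : 'rV[R]_n) :
  convex_function (@orthant R n) f -> Ck 2 f -> orthant x ->
  0 <= 'D_v ('D_v f) x.
Proof.
move=> cvxf f2 x0; apply/ler_addgt0Pl => e e0.
have [d d0 dP] := second_difference_lim v v f2 x0 e0.
have [d' d'0 dP'] := @orthant_line_near R n x v v _ (near_orthant x0).
pose s := Num.min d d'.
have s0 : 0 < s by rewrite lt_min d0.
have sd' : `|s| <= d' by rewrite gtr0_norm// /s ge_min lexx orbT.
have o1 : orthant (x + s *: v + s *: v) by exact: dP'.
have := dP s; rewrite s0 {2}/s ge_min lexx/= => /(_ isT).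
rewrite ler_norml => /andP[_]; rewrite lerBlDr; apply: le_trans.
rewrite divr_ge0 ?sqr_ge0//.
(* The second difference with [v = w] is [f(x + 2sv) - 2 f(x + sv) + f(x)]; its sign is midpoint
   convexity on the segment from [x] to [x + 2sv]. *)
have mid : x + s *: v = 2^-1 *: (x + s *: v + s *: v) + 2^-1 *: x.
  rewrite -scalerDr -!addrA [s *: v + x]addrC.
  have -> : x + (s *: v + (x + s *: v)) = (x + s *: v) *+ 2.
    by rewrite mulr2n addrA.
  by rewrite -[(_ + _) *+ 2]scaler_nat scalerA mulVf ?pnatr_eq0// scale1r.
have h0 : 0 <= 2^-1 :> R by rewrite invr_ge0.
have h1 : 2^-1 <= 1 :> R by rewrite invf_le1// ler1n.
pose t := Itv01 h0 h1.
have := cvxf t _ _ (mem_set o1) (mem_set x0).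
rewrite convRE /conv/= /unstable.onem.
have -> : 1 - 2^-1 = 2^-1 :> R by lra.
rewrite -mid; lra.
Qed.

(* Otherwise unification unfolds nested directional derivatives into limits. *)
#[local] Opaque derive.

Lemma derive_at_min (R : realType) (n : nat) (F : 'rV[R]_n -> R)
    (x w : 'rV[R]_n) :
  C1 F -> orthant x -> (forall y, orthant y -> F x <= F y) -> 'D_w F x = 0.
Proof.
move=> F1 x0 Fmin.
have [d d0 dP] := @orthant_line_near R n x w w _ (near_orthant x0).
have xo u : u \in `]- d, d[ -> orthant (x + u *: w).
  rewrite in_itv/= -ltr_norml => ud.
  by have := dP u 0 (ltW ud); rewrite scale0r addr0 normr0; apply; exact: ltW.
have [|u ud|||_] := @derive1_at_min R (fun u => F (x + u *: w)) (- d) d 0.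
- lra.
- by have /is_derive_line[] := C1_derive w F1 (xo _ ud).
- by rewrite in_itv/= oppr_lt0 d0.
- by move=> u /xo; rewrite scale0r addr0; exact: Fmin.
move=> D0; have dx := C1_derive w F1 x0; have [_ FxE] := dx.
rewrite FxE; have x00 : x + 0 *: w = x by rewrite scale0r addr0.
by rewrite -{1}x00 in dx; have /is_derive_line[_] := dx; rewrite D0.
Qed.

(** Linearity in the direction together with symmetry. Arbitrary [s] serves to test the degeneracy
    of the Hessian; [s = 1] later splits the Hessian form in the direction [v + phi_v]. *)
Lemma derive2_add (R : realType) (n : nat) (f : 'rV[R]_n -> R)
    (x v w : 'rV[R]_n) (s : R) :
  Ck 2 f -> orthant x ->
  'D_(v + s *: w) ('D_(v + s *: w) f) x =
  'D_v ('D_v f) x + 2 * s * 'D_w ('D_v f) x + s ^+ 2 * 'D_w ('D_w f) x.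
Proof.
move=> f2 x0; have d1 u : C1 ('D_u f) by have [] := Ck_derive u f2.
have E u : 'D_u ('D_(v + s *: w) f) x = 'D_u ('D_v f) x + s * 'D_u ('D_w f) x.
  apply: etrans (schwarz (v + s *: w) u f2 x0) _.
  apply: etrans (derive_dirD v w s (d1 u) x0) _.
  exact (congr2 (fun a b : R => a + s * b) (schwarz u v f2 x0) (schwarz u w f2 x0)).
apply: etrans (derive_dirD v w s (d1 (v + s *: w)) x0) _.
apply: etrans (congr2 (fun a b : R => a + s * b) (E v) (E w)) _.
have /= := schwarz w v f2 x0.
move: ('D_v ('D_v f) x) ('D_w ('D_v f) x) ('D_w ('D_w f) x) => A B C ->.
by ring.
Qed.

Section convex_null_direction.
Context (R : realType) (n : nat) (f : 'rV[R]_n -> R) (x v : 'rV[R]_n).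
Hypotheses (cvxf : convex_function (@orthant R n) f) (x0 : orthant x).
Hypothesis fvv0 : 'D_v ('D_v f) x = 0.

Lemma convex_null_derive w : Ck 2 f -> 'D_w ('D_v f) x = 0.
Proof.
move=> f2; set b := LHS.
have q0 : 0 <= 'D_w ('D_w f) x by exact: convex_derive2_ge0.
set q := ('D_w _ x) in q0.
have Q s : 0 <= 2 * s * b + s ^+ 2 * q.
  have := @convex_derive2_ge0 R n f x (v + s *: w) cvxf f2 x0.
  by rewrite derive2_add// fvv0 add0r.
clearbody b q; have q1 : 0 < q + 1 by rewrite ltr_wpDl.
(* A polynomial [2 b s + q s^2] with [q >= 0] that is nonnegative for all [s]
   has [b = 0]; the witness is [s = - b / (q + 1)]. *)
have := Q (- b / (q + 1)).
have -> : 2 * (- b / (q + 1)) * b + (- b / (q + 1)) ^+ 2 * q =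
    - (b ^+ 2 * ((q + 2) / (q + 1) ^+ 2)).
  by field; rewrite gt_eqF.
rewrite oppr_ge0 => H.
have c0 : 0 < (q + 2) / (q + 1) ^+ 2.
  by rewrite divr_gt0 ?exprn_gt0// ltr_wpDl.
move: H; rewrite pmulr_lle0// => H.
by apply/eqP; rewrite -sqrf_eq0 eq_le H sqr_ge0.
Qed.

(** Two exchanges of derivatives bring ['D_w] to the outside, where it acts on the nonnegative
    function ['D_v ('D_v f)] at its minimum point [x]. *)
Lemma convex_null_derive2 w : Ck 3 f -> 'D_v ('D_v ('D_w f)) x = 0.
Proof.
move=> f3; have f2 := CkW f3.
transitivity ('D_v ('D_w ('D_v f)) x).
  by apply: eq_orthant_derive x0 => y y0; exact: schwarz.
transitivity ('D_w ('D_v ('D_v f)) x).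
  exact: schwarz (Ck_derive v f3) x0.
apply: derive_at_min x0 _.
  by have [] := Ck_derive v (Ck_derive v f3).
move=> y y0; apply: (@le_trans _ _ 0); first by rewrite fvv0.
exact: convex_derive2_ge0.
Qed.

End convex_null_direction.

(** * Hoelder classes *)

Definition box (R : realType) (n : nat) (a b : 'rV[R]_n) : set 'rV[R]_n :=
  [set y | forall i, a 0 i <= y 0 i <= b 0 i].

Lemma box_compact (R : realType) (n : nat) (a b : 'rV[R]_n) : compact (box a b).
Proof.
have := @rV_compact R n (fun i => `[a 0 i, b 0 i]%classic)
  (fun i => @segment_compact R _ _).
congr compact; apply/seteqP; split => y /= yab i; have := yab i;
  by rewrite in_itv/=.
Qed.

Lemma box_orthant (R : realType) (n : nat) (a b : 'rV[R]_n) :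
  orthant a -> box a b `<=` orthant (n:=n).
Proof. by move=> a0 y yab i; have /andP[/(lt_le_trans (a0 i))] := yab i. Qed.

(** Hoelder bounds are only available on compact subsets of the orthant; the box from [x / 2] to
    [2 x] is such a set and a neighbourhood of [x], all coordinates of [x] being positive. *)
Lemma near_box (R : realType) (n : nat) (x : 'rV[R]_n) : orthant x ->
  nbhs x (box (2^-1 *: x) (2 *: x)).
Proof.
move=> x0.
apply: (@filter_forall 'rV[R]_n 'I_n
  (fun i => [set y | (2^-1 *: x) 0 i <= y 0 i <= (2 *: x) 0 i]) (nbhs x) _) => i.
have xi := x0 i; have cx := @coord_continuous R 1 n 0 i x.
have lo : (2^-1 *: x) 0 i < x 0 i by rewrite mxE; lra.
have hi : x 0 i < (2 *: x) 0 i by rewrite mxE; lra.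
have H1 := cvgr_gt (FF := nbhs_filter x) _ cx _ lo.
have H2 := cvgr_lt (FF := nbhs_filter x) _ cx _ hi.
by apply: (filterS2 (nbhs_filter x) _ H1 H2) => y /= ay yb; apply/andP; split; exact: ltW.
Qed.

(** Bridges two metrics: neighbourhoods come from the sup norm, Hoelder estimates from the Euclidean
    one. *)
Lemma enorm_cvg0 (R : realType) (n : nat) (x : 'rV[R]_n) (e : R) : 0 < e ->
  \forall y \near x, enorm (x - y) < e.
Proof.
move=> e0.
have cE : {for x, continuous (fun y : 'rV[R]_n => enorm (x - y))}.
  apply: (@continuous_comp _ _ _
    (fun y : 'rV[R]_n => \sum_(i < 1) \sum_(j < n) (x - y) i j ^+ 2) Num.sqrt);
    last exact: sqrt_continuous.
  apply: continuous_at_sum => i; apply: continuous_at_sum => j.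
  have -> : (fun y : 'rV[R]_n => (x - y) i j ^+ 2) =
      (fun y => (x i j - y i j) * (x i j - y i j)).
    by apply/funext => y; rewrite !mxE expr2.
  by apply: continuousM; apply: continuousB;
    [exact: cst_continuous|exact: coord_continuous|
     exact: cst_continuous|exact: coord_continuous].
have := cE; rewrite /prop_for /continuous_at.
have -> : enorm (x - x) = 0.
  rewrite /enorm subrr big1 ?sqrtr0// => i _; rewrite big1// => j _.
  by rewrite mxE expr0n.
by move/cvgr_lt; apply.
Qed.

Lemma holder_continuous (R : realType) (n : nat) (alpha : R)
    (g : 'rV[R]_n -> R) (x : 'rV[R]_n) :
  0 < alpha -> orthant x ->
  locally_holder alpha (@Defs.edist R n) (@orthant R n) g -> {for x, continuous g}.
Proof.
move=> al0 x0 hg.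
have xh : orthant (2^-1 *: x) by move=> i; rewrite mxE mulr_gt0.
have [C [_ gC]] := hg _ (@box_compact R n (2^-1 *: x) (2 *: x)) (box_orthant xh).
have C0 : 0 < `|C| + 1 by rewrite ltr_wpDl.
apply/(@cvgrPdist_le _ _ _ (nbhs x) (nbhs_filter x)) => e e0.
(* Solves [(|C| + 1) d^alpha = e]; the constant [|C| + 1] is a positive majorant of [C]. *)
pose d := (e / (`|C| + 1)) `^ alpha^-1.
have d0 : 0 < d by rewrite powR_gt0// divr_gt0.
have xb : box (2^-1 *: x) (2 *: x) x by exact: nbhs_singleton (near_box x0).
apply: (filterS2 (nbhs_filter x) _ (near_box x0) (enorm_cvg0 x d0)) => y yb xyd.
apply: le_trans (gC _ _ xb yb) _.
have E0 : 0 <= Defs.edist x y `^ alpha by exact: powR_ge0.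
apply: (@le_trans _ _ ((`|C| + 1) * Defs.edist x y `^ alpha)).
  by rewrite ler_wpM2r// (le_trans (ler_norm _))// lerDl.
rewrite -ler_pdivlMl// mulrC.
have -> : e / (`|C| + 1) = d `^ alpha.
  by rewrite /d -powRrM mulVf ?gt_eqF// powRr1// divr_ge0 ?ltW.
by apply: ge0_ler_powR; rewrite ?nnegrE ?(ltW al0) ?(ltW d0) ?sqrtr_ge0// ltW.
Qed.

Lemma Ck_of_partials (R : realType) (n k : nat) (f : 'rV[R]_n -> R) :
  has_partials k f ->
  (forall s : seq 'I_n, (size s <= k)%N -> forall x, orthant x ->
    {for x, continuous (iter_partial s f)}) ->
  Ck k f.
Proof.
elim: k f => // k IH f pf cf; split.
  move=> i x x0; split; first exact: (pf [::]).
  exact: (cf [:: i]).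
(* The last entry of the list is the derivative taken first, hence [rcons] and not [cons]. *)
have E i s : iter_partial (rcons s i) f = iter_partial s ('D_(delta_mx 0 i) f).
  by rewrite /iter_partial foldr_rcons.
move=> i; apply: IH => [s j sk x x0|s sk x x0].
  by rewrite -E; apply: pf; rewrite ?size_rcons.
by rewrite -E; apply: cf; rewrite ?size_rcons.
Qed.

Lemma C_holder_Ck (R : realType) (n p : nat) (alpha : R) (f : 'rV[R]_n -> R) :
  0 < alpha -> C_holder p alpha f -> Ck p f.
Proof.
move=> al0 [pf hf]; apply: Ck_of_partials => // s sp x x0.
exact: holder_continuous (hf s sp).
Qed.

(** On a compact set times the single time [t], the parabolic distance reduces to the Euclidean
    one. *)
Lemma holder_par_slice (R : realType) (n : nat) (alpha T t : R)
    (g : 'rV[R]_n * R -> R) :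
  0 <= t <= T ->
  locally_holder alpha (@pdist R n) (@cylinder R n T) g ->
  locally_holder alpha (@Defs.edist R n) (@orthant R n) (fun x => g (x, t)).
Proof.
move=> tT hg K cK Ko.
have [||C [C1 C2]] := hg (K `*` [set t]).
- apply: compact_setX => //; exact: compact_set1.
- by move=> [y u] [/= /Ko yo ->].
exists C; split=> [y Ky|y y' Ky Ky']; first exact: C1.
have := C2 (y, t) (y', t) (conj Ky erefl) (conj Ky' erefl).
by rewrite /pdist/= subrr normr0 sqrtr0 addr0.
Qed.

Lemma C_holder_par_Ck (R : realType) (n p : nat) (alpha T t : R)
    (g : 'rV[R]_n -> R -> R) :
  0 < alpha -> 0 <= t <= T -> C_holder_par p alpha T g -> Ck p (g^~ t).
Proof.
move=> al0 tT [pg hg]; apply: Ck_of_partials => [|s sp x x0]; first exact: pg.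
exact: holder_continuous (holder_par_slice tT (hg s sp)).
Qed.

(** * Differentiation under the integral over the jump sizes *)

From mathcomp Require Import measurable_realfun.

Definition bounded_family (R : realType) (r : R) (g : R -> R -> R) : Prop :=
  exists C : R, forall h z, `|h| < r -> 0 <= z <= 1 -> `|g h z| <= C.

Definition measurable_family (R : realType) (r : R) (g : R -> R -> R) : Prop :=
  forall h, `|h| < r -> measurable_fun (`[0, 1] : set R) (g h).

(** Bundles what the Leibniz rule asks of a parametric integrand, with constants as dominating
    functions, in a form stable under sums, products and composition. Measurability of [g'] is
    deduced afterwards from that of [g]. *)
Definition derive_family (R : realType) (r : R) (g g' : R -> R -> R) : Prop :=
  [/\ bounded_family r g, measurable_family r g, bounded_family r g' &
      forall h z, `|h| < r -> 0 <= z <= 1 -> is_derive h (1 : R) (g^~ z) (g' h z)].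

Section bounded_family.
Context (R : realType) (r : R).
Implicit Types g : R -> R -> R.

Lemma bounded_family_ext g1 g2 :
  (forall h z, `|h| < r -> 0 <= z <= 1 -> g1 h z = g2 h z) ->
  bounded_family r g1 -> bounded_family r g2.
Proof. by move=> g12 [C gC]; exists C => h z hr z01; rewrite -g12// gC. Qed.

Lemma bounded_familyD g1 g2 : bounded_family r g1 -> bounded_family r g2 ->
  bounded_family r (fun h z => g1 h z + g2 h z).
Proof.
move=> [C gC] [D gD]; exists (C + D) => h z hr z01.
by rewrite (le_trans (ler_normD _ _))// lerD ?gC ?gD.
Qed.

Lemma bounded_familyM g1 g2 : bounded_family r g1 -> bounded_family r g2 ->
  bounded_family r (fun h z => g1 h z * g2 h z).
Proof.
move=> [C gC] [D gD]; exists (C * D) => h z hr z01.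
by rewrite normrM ler_pM ?gC ?gD.
Qed.

Lemma bounded_family_cst (c : R) : bounded_family r (fun _ _ => c).
Proof. by exists `|c|. Qed.

Lemma bounded_family_sum (I : Type) (s : seq I) (g : I -> R -> R -> R) :
  (forall i, bounded_family r (g i)) ->
  bounded_family r (fun h z => \sum_(i <- s) g i h z).
Proof.
move=> gb; elim: s => [|i s IH].
  by apply: bounded_family_ext (bounded_family_cst 0) => h z; rewrite big_nil.
by apply: bounded_family_ext (bounded_familyD (gb i) IH) => h z; rewrite big_cons.
Qed.

End bounded_family.

Section derive_family.
Context (R : realType) (r : R).
Implicit Types g : R -> R -> R.

Lemma derive_familyD g1 g1' g2 g2' :
  derive_family r g1 g1' -> derive_family r g2 g2' ->
  derive_family r (fun h z => g1 h z + g2 h z) (fun h z => g1' h z + g2' h z).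
Proof.
move=> [b1 m1 b1' d1] [b2 m2 b2' d2]; split.
- exact: bounded_familyD.
- by move=> h hr; apply: measurable_funD; [exact: m1|exact: m2].
- exact: bounded_familyD.
- by move=> h z hr z01; exact: is_deriveD (d1 _ _ hr z01) (d2 _ _ hr z01).
Qed.

Lemma derive_familyM g1 g1' g2 g2' :
  derive_family r g1 g1' -> derive_family r g2 g2' ->
  derive_family r (fun h z => g1 h z * g2 h z)
    (fun h z => g1' h z * g2 h z + g1 h z * g2' h z).
Proof.
move=> [b1 m1 b1' d1] [b2 m2 b2' d2]; split.
- exact: bounded_familyM.
- by move=> h hr; apply: measurable_funM; [exact: m1|exact: m2].
- by apply: bounded_familyD; exact: bounded_familyM.
- move=> h z hr z01.
  apply: is_derive_eq (is_deriveM (d1 _ _ hr z01) (d2 _ _ hr z01)) _.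
  by rewrite addrC /GRing.scale/= [g2 h z * _]mulrC.
Qed.

Lemma derive_family_cst (c : R) : derive_family r (fun _ _ => c) (fun _ _ => 0).
Proof.
split; [exact: bounded_family_cst| |exact: bounded_family_cst|].
- by move=> h _; exact: measurable_cst.
- by move=> h z _ _; exact: is_derive_cst.
Qed.

Lemma derive_family_ext g1 g1' g2 g2' :
  (forall h z, g1 h z = g2 h z) -> (forall h z, g1' h z = g2' h z) ->
  derive_family r g1 g1' -> derive_family r g2 g2'.
Proof.
move=> E E'; have -> : g1 = g2 by apply/funext => h; apply/funext => z.
by have -> : g1' = g2' by apply/funext => h; apply/funext => z.
Qed.

Lemma derive_familyB g1 g1' g2 g2' :
  derive_family r g1 g1' -> derive_family r g2 g2' ->
  derive_family r (fun h z => g1 h z - g2 h z) (fun h z => g1' h z - g2' h z).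
Proof.
move=> d1 d2.
apply: derive_family_ext
    (derive_familyD d1 (derive_familyM (derive_family_cst (-1)) d2)) => h z /=.
  by rewrite mulN1r.
by rewrite mul0r add0r mulN1r.
Qed.

Lemma derive_family_sum (I : Type) (s : seq I) (g g' : I -> R -> R -> R) :
  (forall i, derive_family r (g i) (g' i)) ->
  derive_family r (fun h z => \sum_(i <- s) g i h z)
    (fun h z => \sum_(i <- s) g' i h z).
Proof.
move=> gd; elim: s => [|i s IH].
  by apply: derive_family_ext (derive_family_cst 0) => h z; rewrite big_nil.
by apply: derive_family_ext (derive_familyD (gd i) IH) => h z; rewrite big_cons.
Qed.

Lemma integrable_family g h : bounded_family r g -> measurable_family r g ->
  `|h| < r -> (@lebesgue_measure R).-integrable `[0, 1] (EFin \o g h).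
Proof.
move=> [C gC] mg hr; apply: measurable_bounded_integrable => //.
- apply: le_lt_trans (ltry 1); rewrite le_eqVlt; apply/orP; left; apply/eqP.
  have : lebesgue_measure (`[0, 1]%classic : set R) = 1%:E.
    by rewrite lebesgue_measure_itv/= lte_fin ltr01 oppr0 adde0.
  exact.
- exact: mg.
- exists C; split; first exact: num_real.
  move=> D CD z /=; rewrite in_itv/= => z01.
  by rewrite (le_trans (gC _ _ hr z01))// ltW.
Qed.

Lemma near_family (h : R) : `|h| < r -> \forall k \near h, `|k| < r.
Proof.
move=> hr.
have /cvgr_lt := @norm_continuous _ R h.
by apply.
Qed.

(** The derivative is a pointwise limit of difference quotients, each of them measurable in [z]. *)
Lemma derive_family_measurable g g' : derive_family r g g' -> measurable_family r g'.
Proof.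
move=> [_ mg _ dg] h hr.
have e0 : 0 < (r - `|h|) by rewrite subr_gt0.
(* Dividing by [k + 2] rather than [k + 1] makes every step strictly smaller than [r - |h|], the
   first one included. *)
pose u (k : nat) : R := (r - `|h|) / k.+2%:R.
have u0 k : 0 < u k by rewrite divr_gt0.
have uh k : `|h + u k| < r.
  rewrite (le_lt_trans (ler_normD _ _))// -ltrBrDl gtr0_norm//.
  by rewrite ltr_pdivrMr// ltr_pMr// ltr1n.
apply: (@measurable_fun_cvg _ _ _ _ (fun k z => (u k)^-1 * (g (h + u k) z - g h z))).
  move=> k; apply: measurable_funM; first exact: measurable_cst.
  by apply: measurable_funB; apply: mg.
move=> z; rewrite /= in_itv/= => z01.
have [dgz <-] := dg h z hr z01.
move: (dgz) => /cvg_ex[/= l gl].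
have -> : 'D_1 (g^~ z) h = l by exact: cvg_lim gl.
have ucvg : (forall k, u k != 0) /\ u k @[k --> \oo] --> (0 : R).
  split=> [k|]; first by rewrite gt_eqF.
  rewrite -[X in _ --> X](mulr0 (r - `|h|)).
  apply: cvgM; first exact: cvg_cst.
  by have := @cvg_harmonic R; rewrite -cvg_shiftS.
move: gl => /cvgr_dnbhsP/(_ _ ucvg); apply: cvg_trans.
apply: near_eq_cvg; apply: nearW => k /=.
by rewrite /GRing.scale/= mulr1 [u k + h]addrC.
Qed.

Lemma derive_integral g g' h : derive_family r g g' -> `|h| < r ->
  is_derive h (1 : R) (fun k => \int[lebesgue_measure]_(z in `[0, 1]) g k z)
    (\int[lebesgue_measure]_(z in `[0, 1]) g' h z).
Proof.
move=> gd hr; have [bg mg [C gC] dg] := gd.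
have Ih : `](- r), r[%classic h by rewrite /= in_itv/= -ltr_norml.
have Ir k : `](- r), r[%classic k -> `|k| < r by rewrite /= in_itv/= -ltr_norml.
have mI : measurable (`[0, 1]%classic : set (measurableTypeR R)).
  exact: measurable_itv.
have I1 k : `](- r), r[%classic k ->
    (@lebesgue_measure R).-integrable `[0, 1] (EFin \o g k).
  by move=> /Ir; exact: integrable_family.
have I2 k z : `](- r), r[%classic k -> `[0, 1]%classic z -> derivable (g^~ z) k 1.
  by move=> /Ir kr; rewrite /= in_itv/= => z01; have [] := dg k z kr z01.
have I3 k z : `](- r), r[%classic k -> `[0, 1]%classic z ->
    partial1of2 g k z = g' k z.
  move=> /Ir kr; rewrite /= in_itv/= => z01; rewrite partial1of2E.
  by have [_ ->] := dg k z kr z01.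
(* The dominating function is a constant, whose absolute value is taken to make nonnegativity
   immediate. *)
have I4 (z : R) : 0 <= `|C| := normr_ge0 C.
have I5 : (@lebesgue_measure R).-integrable `[0, 1] (EFin \o (fun=> `|C|)).
  exact: (@integrable_family (fun _ _ => `|C|) h (bounded_family_cst r _)
    (fun _ _ => measurable_cst _)).
have I6 k z : `](- r), r[%classic k -> `[0, 1]%classic z ->
    `|partial1of2 g k z| <= `|C|.
  move=> kr z01; rewrite I3//; apply: le_trans (ler_norm C).
  by apply: gC; [exact: Ir|move: z01; rewrite /= in_itv].
split; first exact: (derivable_under_integral mI Ih I1 I2 I4 I5 I6).
rewrite -derive1E (differentiation_under_integral mI Ih I1 I2 I4 I5 I6).
by apply: eq_Rintegral => z; rewrite inE => z01; exact: I3.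
Qed.

End derive_family.

(** * Composition with paths that stay in a compact box *)

Section derive_family_chain.
Context (R : realType) (n : nat) (r : R) (a b : 'rV[R]_n).
Context (p : R -> R -> 'rV[R]_n) (q : 'I_n -> R -> R -> R).
Hypothesis a_gt0 : orthant a.
Hypothesis p_box : forall h z, `|h| < r -> 0 <= z <= 1 -> box a b (p h z).
Hypothesis p_meas : forall h, `|h| < r -> forall O : set 'rV[R]_n, open O ->
  measurable ((`[0, 1]%classic : set (measurableTypeR R)) `&` p h @^-1` O).
Hypothesis p_derive : forall i,
  bounded_family r (q i) /\
  forall h z, `|h| < r -> 0 <= z <= 1 ->
    is_derive h (1 : R) (fun k => p k z 0 i) (q i h z).

(** Uniformity in [h] and [z] comes from compactness: all points [p h z] lie in one box of the
    orthant, on which [F] is bounded. *)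
Lemma bounded_family_comp (F : 'rV[R]_n -> R) :
  (forall x, orthant x -> {for x, continuous F}) ->
  bounded_family r (fun h z => F (p h z)).
Proof.
move=> cF.
have cFb : {within box a b, continuous F}.
  apply: continuous_in_subspaceT => y; rewrite inE => yab.
  exact/cF/(box_orthant a_gt0 yab).
have [M [_ MF]] := compact_bounded (continuous_compact cFb (@box_compact R n a b)).
exists (M + 1) => h z hr z01; apply: (MF (M + 1)); first by rewrite ltrDl.
by exists (p h z) => //; exact: p_box.
Qed.

Lemma measurable_family_comp (F : 'rV[R]_n -> R) :
  (forall x, orthant x -> {for x, continuous F}) ->
  measurable_family r (fun h z => F (p h z)).
Proof.
move=> cF h hr.
apply: (measurability _ (RGenOpens.measurableE R)).
move=> _ [_ [u [w ->] <-]].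
(* Since [F] is continuous on the orthant only, its preimage of an interval is cut down to the
   orthant to be open; the path never leaves the orthant, so nothing is lost. *)
pose O := [set y | orthant y /\ `]u, w[%classic (F y)].
have -> : `[0, 1]%classic `&` (fun z => F (p h z)) @^-1` `]u, w[%classic =
    `[0, 1]%classic `&` p h @^-1` O.
  apply/seteqP; split=> z [z01 Fz]; last by split; [|case: Fz].
  split=> //; split=> //; apply: (box_orthant a_gt0 (b := b)); apply: p_box => //.
apply: p_meas => //.
rewrite openE => y [y0 Fy].
apply: filterI; first exact: near_orthant.
by apply: (cF y y0); apply: open_nbhs_nbhs; split => //; exact: interval_open.
Qed.

Lemma derive_family_comp (F : 'rV[R]_n -> R) : C1 F ->
  derive_family r (fun h z => F (p h z))
    (fun h z => \sum_i q i h z * 'D_(delta_mx 0 i) F (p h z)).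
Proof.
move=> F1; split.
- by apply: bounded_family_comp => x; exact: C1_continuous.
- by apply: measurable_family_comp => x; exact: C1_continuous.
- apply: bounded_family_sum => i; apply: bounded_familyM.
    exact: (p_derive i).1.
  apply: (bounded_family_comp (F := 'D_(delta_mx 0 i) F)) => x x0.
  by have [] := F1 i x x0.
- move=> h z hr z01; apply: (C1_chain (p := fun k => p k z) F1).
    exact: (box_orthant a_gt0 (p_box hr z01)).
  by move=> i; exact: (p_derive i).2.
Qed.

End derive_family_chain.

(** Joint Borel measurability passes to the slice because [z] maps continuously to [(y, t, z)]; the
    translation by [y] is absorbed into the open set. *)
Lemma measurable_slice_preimage (R : realType) (n : nat) (T t : R)
    (phi : 'rV[R]_n -> R -> R -> 'rV[R]_n) (y : 'rV[R]_n) (O : set 'rV[R]_n) :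
  @measurable_fun _ _
    (g_sigma_algebraType (@open ('rV[R]_n * R * R)%type))
    (g_sigma_algebraType (@open 'rV[R]_n))
    [set p | [/\ orthant p.1.1, 0 <= p.1.2 <= T & 0 <= p.2 <= 1]]
    (fun p => phi p.1.1 p.1.2 p.2) ->
  orthant y -> 0 <= t <= T -> open O ->
  measurable ((`[0, 1]%classic : set (measurableTypeR R)) `&`
    (fun z => y + phi y t z) @^-1` O).
Proof.
move=> mphi y0 tT oO.
have mopen (A : set ('rV[R]_n * R * R)) : open A ->
    @measurable _ (g_sigma_algebraType (@open ('rV[R]_n * R * R)%type)) A.
  by move=> oA; exact: sub_sigma_algebra.
have mclosed (A : set ('rV[R]_n * R * R)) : closed A ->
    @measurable _ (g_sigma_algebraType (@open ('rV[R]_n * R * R)%type)) A.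
  by move=> cA; rewrite -[A]setCK; apply: measurableC; apply: mopen; exact: closed_openC.
have c11 : continuous (fun p : 'rV[R]_n * R * R => p.1.1).
  by move=> p; apply: continuous_comp; exact: cvg_fst.
have c12 : continuous (fun p : 'rV[R]_n * R * R => p.1.2).
  by move=> p; apply: continuous_comp; [exact: cvg_fst|exact: cvg_snd].
have c2 : continuous (fun p : 'rV[R]_n * R * R => p.2) by move=> p; exact: cvg_snd.
have mD : @measurable _ (g_sigma_algebraType (@open ('rV[R]_n * R * R)%type))
    [set p | [/\ orthant p.1.1, 0 <= p.1.2 <= T & 0 <= p.2 <= 1]].
  have -> : [set p : 'rV[R]_n * R * R |
        [/\ orthant p.1.1, 0 <= p.1.2 <= T & 0 <= p.2 <= 1]] =
      ((fun p => p.1.1) @^-1` (@orthant R n)) `&`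
      (((fun p => p.1.2) @^-1` `[0, T]%classic) `&`
       ((fun p => p.2) @^-1` `[0, 1]%classic)).
    by apply/seteqP; split=> p /=; rewrite !in_itv/=; [case|case=> ? []].
  apply: measurableI; [|apply: measurableI].
  - apply: mopen; apply: open_comp => [p _|]; first exact: c11.
    by rewrite openE => z; exact: near_orthant.
  - apply: mclosed; apply: closed_comp => [p _|]; first exact: c12.
    exact: interval_closed.
  - apply: mclosed; apply: closed_comp => [p _|]; first exact: c2.
    exact: interval_closed.
have oO' : open ((fun w => y + w) @^-1` O).
  apply: open_comp => // w _.
  by apply: continuousD; [exact: cst_continuous|exact: cvg_id].
have mE := mphi mD _ (@sub_sigma_algebra _ setT (@open 'rV[R]_n) _ oO').
have mi : @measurable_fun _ _ (measurableTypeR R)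
    (g_sigma_algebraType (@open ('rV[R]_n * R * R)%type)) setT
    (fun z : R => (y, t, z)).
  apply: (@measurability _ _ (measurableTypeR R)
    (g_sigma_algebraType (@open ('rV[R]_n * R * R)%type)) setT
    (fun z : R => (y, t, z)) (@open ('rV[R]_n * R * R)%type) erefl).
  move=> _ [A oA <-]; rewrite setTI.
  apply: open_measurable; apply: open_comp => // z _.
  move=> B [[P Q] /= [yP zQ] PQB]; apply: filterS zQ => w Qw.
  by apply: (PQB (y, t, w)); split => //=; exact: nbhs_singleton yP.
have := mi measurableT _ mE; rewrite setTI.
congr measurable; apply/seteqP; split=> z /=; rewrite in_itv/=.
  by move=> [[_ _ ?] ?].
by move=> [? ?].
Qed.

(** * The jump operator along a line *)

Lemma bounded_family_derive (R : realType) (n : nat) (r : R) (v : 'rV[R]_n)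
    (F : R -> 'rV[R]_n -> R) (y : R -> 'rV[R]_n) :
  (forall z, 0 <= z <= 1 -> C1 (F z)) ->
  (forall h, `|h| < r -> orthant (y h)) ->
  (forall i, bounded_family r (fun h z => 'D_(delta_mx 0 i) (F z) (y h))) ->
  bounded_family r (fun h z => 'D_v (F z) (y h)).
Proof.
move=> F1 yo Fb.
apply: (@bounded_family_ext _ _
    (fun h z => \sum_i v 0 i * 'D_(delta_mx 0 i) (F z) (y h))).
  by move=> h z hr z01; have [_ ->] := C1_derive v (F1 z z01) (yo h hr).
apply: bounded_family_sum => i; apply: bounded_familyM; last exact: Fb.
exact: bounded_family_cst.
Qed.

Lemma C1_derive_line (R : realType) (n : nat) (F : 'rV[R]_n -> R)
    (x v : 'rV[R]_n) (h : R) :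
  C1 F -> orthant (x + h *: v) ->
  is_derive h (1 : R) (fun k => F (x + k *: v)) ('D_v F (x + h *: v)).
Proof.
move=> F1 xo; apply/is_derive_line.
by have [df _] := C1_derive v F1 xo; exact: derivableP df.
Qed.

Section line_families.
Context (R : realType) (n : nat) (x v : 'rV[R]_n) (r gamma : R).
Context (phi : 'rV[R]_n -> R -> 'rV[R]_n).
Hypothesis x_gt0 : orthant x.
Hypothesis r_gt0 : 0 < r.
Hypothesis line_box : forall h, `|h| < r ->
  box (2^-1 *: x) (2 *: x) (x + h *: v).
Hypothesis phi_Ck : forall i z, 0 <= z <= 1 -> Ck 2 (fun y => phi y z 0 i).
Hypothesis phi_bound : forall i, exists C : R, forall z, 0 <= z <= 1 ->
  forall s : seq 'I_n, (size s <= 2)%N ->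
  forall y, box (2^-1 *: x) (2 *: x) y ->
  `|iter_partial s (fun y => phi y z 0 i) y| <= C.
Hypothesis gamma_gtN1 : -1 < gamma.
Hypothesis phi_lower : forall y z i, orthant y -> 0 <= z <= 1 ->
  gamma * y 0 i < phi y z 0 i.
Hypothesis phi_meas : forall y, orthant y -> forall O : set 'rV[R]_n, open O ->
  measurable ((`[0, 1]%classic : set (measurableTypeR R)) `&`
    (fun z => y + phi y z) @^-1` O).

Notation phi_ i z := (fun y => phi y z 0 i).
Notation line h := (x + h *: v).
Notation jump h z := (x + h *: v + phi (x + h *: v) z).

Let half_orthant : orthant (2^-1 *: x).
Proof. by move=> i; rewrite mxE mulr_gt0. Qed.

Let line_orthant h : `|h| < r -> orthant (line h).
Proof. by move=> hr; exact: box_orthant half_orthant _ (line_box hr). Qed.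

Let phi_coord_bounded i s : (size s <= 2)%N ->
  bounded_family r (fun h z => iter_partial s (phi_ i z) (line h)).
Proof.
move=> s2; have [C phiC] := phi_bound i.
by exists C => h z hr z01; apply: phiC => //; exact: line_box.
Qed.

Lemma line_family (F : 'rV[R]_n -> R) : C1 F ->
  derive_family r (fun h _ => F (line h)) (fun h _ => 'D_v F (line h)).
Proof.
move=> F1; split.
- apply: (bounded_family_comp (p := fun h _ => line h) half_orthant) => [h z hr _|y].
    exact: line_box.
  exact: C1_continuous.
- by move=> h hr; exact: measurable_cst.
- apply: (@bounded_family_comp _ _ _ _ _ (fun h _ => line h) half_orthant _
    ('D_v F)) => [h z hr _|y y0].
    exact: line_box.
  exact: C1_derive_continuous.
- by move=> h z hr _; exact: C1_derive_line F1 (line_orthant hr).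
Qed.

(** Choosing the bounds on [phi] as a function of [i] allows a corner [top] to be formed. For the
    other corner, [y_i >= x_i / 2] and [phi_i > gamma y_i] give
    [y_i + phi_i >= (1 + gamma) x_i / 2 > 0]. *)
Let bound_ (i : 'I_n) : R := sval (cid (phi_bound i)).

Let top : 'rV[R]_n := \row_i (2 * x 0 i + bound_ i).

Let bot : 'rV[R]_n := ((1 + gamma) * 2^-1) *: x.

Let bot_orthant : orthant bot.
Proof. by move=> i; rewrite mxE !mulr_gt0 ?invr_gt0// -ltrBlDl sub0r. Qed.

Let jump_box h z : `|h| < r -> 0 <= z <= 1 -> box bot top (jump h z).
Proof.
move=> hr z01 i.
have := line_box hr i; have := phi_lower i (line_orthant hr) z01.
have := svalP (cid (phi_bound i)) z z01 [::] isT _ (line_box hr).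
rewrite -/(bound_ i) /= ler_norml /bot /top.
rewrite !mxE; move: (phi _ _ 0 i) => c /andP[_ c1] c2 /andP[H1 H2].
apply/andP; split; last by rewrite lerD.
apply: (@le_trans _ _ ((1 + gamma) * (x 0 i + h * v 0 i))).
  rewrite -mulrA ler_wpM2l//; first by rewrite -lerBlDl sub0r ltW.
by rewrite mulrDl mul1r lerD2l ltW.
Qed.

Let jump_meas h : `|h| < r -> forall O : set 'rV[R]_n, open O ->
  measurable ((`[0, 1]%classic : set (measurableTypeR R)) `&`
    (fun z => jump h z) @^-1` O).
Proof. by move=> hr O oO; apply: phi_meas => //; exact: line_orthant. Qed.

Lemma phi_family i :
  derive_family r (fun h z => phi (line h) z 0 i)
    (fun h z => 'D_v (phi_ i z) (line h)).
Proof.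
split.
- exact: (@phi_coord_bounded i [::]).
- move=> h hr.
  (* Measurability is known for the landing point [y + phi], so [phi] is recovered as landing point
     minus starting point. *)
  have E z : phi (line h) z 0 i = jump h z 0 i - line h 0 i by rewrite !mxE; ring.
  rewrite (_ : (fun z => _) = fun z => jump h z 0 i - line h 0 i); last exact/funext.
  apply: measurable_funB; last exact: measurable_cst.
  apply: (@measurable_family_comp _ _ _ _ _ (fun h z => jump h z) bot_orthant
    jump_box jump_meas (fun y => y 0 i)) => // y _.
  exact: coord_continuous.
- apply: bounded_family_derive => [z z01|//|j]; first by have [] := phi_Ck i z01.
  exact: (@phi_coord_bounded i [:: j]).
- by move=> h z hr z01; exact: C1_derive_line (phi_Ck i z01).1 (line_orthant hr).
Qed.

Lemma phi_derive_family i :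
  derive_family r (fun h z => 'D_v (phi_ i z) (line h))
    (fun h z => 'D_v ('D_v (phi_ i z)) (line h)).
Proof.
have phi1 := phi_family i; have [_ _ b _] := phi1; split.
- exact: b.
- exact: derive_family_measurable phi1.
- apply: bounded_family_derive => [z z01|h|j]; [|exact: line_orthant|].
    by have [] := Ck_derive v (phi_Ck i z01).
  (* The available bounds concern coordinate derivatives of [phi]. Exchanging the two derivatives
     puts the coordinate one inside, and expanding the remaining ['D_v] leaves pure second
     partials. *)
  apply: (@bounded_family_ext _ _
      (fun h z => 'D_v ('D_(delta_mx 0 j) (phi_ i z)) (line h))).
    by move=> h z hr z01; exact: schwarz (phi_Ck i z01) (line_orthant hr).
  apply: bounded_family_derive => [z z01|//|k].
    by have [_ /(_ j)[]] := phi_Ck i z01.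
  exact: (@phi_coord_bounded i [:: k; j]).
- move=> h z hr z01.
  exact: C1_derive_line (Ck_derive v (phi_Ck i z01)).1 (line_orthant hr).
Qed.

Lemma jump_family (F : 'rV[R]_n -> R) : C1 F ->
  derive_family r (fun h z => F (jump h z))
    (fun h z => \sum_i (v 0 i + 'D_v (phi_ i z) (line h)) *
      'D_(delta_mx 0 i) F (jump h z)).
Proof.
move=> F1.
apply: (@derive_family_comp _ _ _ _ _ (fun h z => jump h z)
  (fun i h z => v 0 i + 'D_v (phi_ i z) (line h)) bot_orthant jump_box
  jump_meas _ F F1) => i.
have [_ _ b d] := phi_family i; split.
  by apply: bounded_familyD b; exact: bounded_family_cst.
move=> h z hr z01.
have -> : (fun k => jump k z 0 i) =
    (fun k : R => (x 0 i + k * v 0 i) + phi (line k) z 0 i).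
  by apply/funext => k; rewrite !mxE.
apply: is_deriveD (d h z hr z01).
have := is_deriveD (is_derive_cst (x 0 i) h 1)
  (is_deriveM (is_derive_id h (1 : R)) (is_derive_cst (v 0 i) h (1 : R))).
move/is_derive_eq; apply.
by rewrite /GRing.scale/= mulr0 mulr1 !add0r.
Qed.

Section test_function.
Variable f : 'rV[R]_n -> R.
Hypothesis f4 : Ck 4 f.

Let f1 : C1 f. Proof. by case: f4. Qed.
Let f2 : Ck 2 f. Proof. exact: CkW (CkW f4). Qed.
Let fi3 i : Ck 3 ('D_(delta_mx 0 i) f). Proof. exact: f4.2. Qed.

Lemma integrand_family :
  derive_family r
    (fun h z => f (jump h z) - f (line h) -
      \sum_i phi (line h) z 0 i * 'D_(delta_mx 0 i) f (line h))
    (fun h z =>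
      (\sum_i (v 0 i + 'D_v (phi_ i z) (line h)) * 'D_(delta_mx 0 i) f (jump h z))
      - 'D_v f (line h)
      - \sum_i ('D_v (phi_ i z) (line h) * 'D_(delta_mx 0 i) f (line h) +
          phi (line h) z 0 i * 'D_v ('D_(delta_mx 0 i) f) (line h))).
Proof.
apply: derive_familyB.
  by apply: derive_familyB; [exact: jump_family|exact: line_family].
apply: derive_family_sum => i; apply: derive_familyM; first exact: phi_family.
by apply: line_family; have [] := fi3 i.
Qed.

(** The derivative is left exactly as the sum and product rules produce it, including the [0 +]; it
    is simplified only at [h = 0], where the null direction makes terms vanish. *)
Lemma integrand_derive_family :
  derive_family r
    (fun h z =>
      (\sum_i (v 0 i + 'D_v (phi_ i z) (line h)) * 'D_(delta_mx 0 i) f (jump h z))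
      - 'D_v f (line h)
      - \sum_i ('D_v (phi_ i z) (line h) * 'D_(delta_mx 0 i) f (line h) +
          phi (line h) z 0 i * 'D_v ('D_(delta_mx 0 i) f) (line h)))
    (fun h z =>
      (\sum_i ((0 + 'D_v ('D_v (phi_ i z)) (line h)) * 'D_(delta_mx 0 i) f (jump h z) +
        (v 0 i + 'D_v (phi_ i z) (line h)) *
          \sum_j (v 0 j + 'D_v (phi_ j z) (line h)) *
            'D_(delta_mx 0 j) ('D_(delta_mx 0 i) f) (jump h z)))
      - 'D_v ('D_v f) (line h)
      - \sum_i (
         ('D_v ('D_v (phi_ i z)) (line h) * 'D_(delta_mx 0 i) f (line h) +
          'D_v (phi_ i z) (line h) * 'D_v ('D_(delta_mx 0 i) f) (line h)) +
         ('D_v (phi_ i z) (line h) * 'D_v ('D_(delta_mx 0 i) f) (line h) +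
          phi (line h) z 0 i * 'D_v ('D_v ('D_(delta_mx 0 i) f)) (line h)))).
Proof.
have fi1 i : C1 ('D_(delta_mx 0 i) f) by have [] := fi3 i.
apply: derive_familyB.
  apply: derive_familyB.
    apply: derive_family_sum => i; apply: derive_familyM.
      by apply: derive_familyD; [exact: derive_family_cst|exact: phi_derive_family].
    exact: jump_family.
  by apply: line_family; have [] := Ck_derive v f2.
apply: derive_family_sum => i; apply: derive_familyD; apply: derive_familyM.
- exact: phi_derive_family.
- exact: line_family.
- exact: phi_family.
- by apply: line_family; have [] := Ck_derive v (fi3 i).
Qed.

End test_function.

End line_families.

(** * Pointwise simplification of the integrand *)

Section derive_coord.
Context (R : realType) (n : nat) (G : 'rV[R]_n -> 'rV[R]_n) (v : 'rV[R]_n).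
Hypothesis G2 : forall i, Ck 2 (fun y => G y 0 i).

(** Connects the vector-valued [phi_v] of the final formula with the componentwise derivatives used
    under the integral. *)
Lemma derive_coord x i : orthant x ->
  ('D_v G x) 0 i = 'D_v (fun y => G y 0 i) x.
Proof.
move=> x0; rewrite derive_mx ?mxE//; apply/derivable_mxP => j k; rewrite ord1.
by have [] := C1_derive v (G2 k).1 x0.
Qed.

Lemma derive2_coord x i : orthant x ->
  ('D_v ('D_v G) x) 0 i = 'D_v ('D_v (fun y => G y 0 i)) x.
Proof.
move=> x0.
have E k : forall y, orthant y -> 'D_v (fun y => G y 0 k) y = ('D_v G y) 0 k.
  by move=> y y0; rewrite derive_coord.
rewrite derive_mx ?mxE; first exact: esym (eq_orthant_derive (E i) v x0).
apply/derivable_mxP => j k; rewrite ord1.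
apply: near_eq_derivable (eq_orthant_near (E k) x0) _.
by have [] := C1_derive v (Ck_derive v (G2 k)).1 x0.
Qed.

End derive_coord.

Lemma dotv_grad (R : realType) (n : nat) (F : 'rV[R]_n -> R) (w y : 'rV[R]_n) :
  C1 F -> orthant y -> dotv w (grad F y) = 'D_w F y.
Proof.
move=> F1 y0; have [_ ->] := C1_derive w F1 y0.
by apply: eq_bigr => i _; rewrite mxE.
Qed.

Lemma derive2_sum (R : realType) (n : nat) (f : 'rV[R]_n -> R) (w y : 'rV[R]_n) :
  Ck 2 f -> orthant y ->
  \sum_i w 0 i * 'D_w ('D_(delta_mx 0 i) f) y = 'D_w ('D_w f) y.
Proof.
move=> f2 y0; have [_ ->] := C1_derive w (Ck_derive w f2).1 y0.
apply: eq_bigr => i _.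
by have -> := schwarz (delta_mx 0 i) w f2 y0.
Qed.

Lemma hess_form (R : realType) (n : nat) (f : 'rV[R]_n -> R) (w y : 'rV[R]_n) :
  Ck 2 f -> orthant y -> (w *m hess f y *m w^T) 0 0 = 'D_w ('D_w f) y.
Proof.
move=> f2 y0; rewrite -derive2_sum// mxE; apply: eq_bigr => i _.
rewrite !mxE mulrC; congr (_ * _).
have [_ ->] := C1_derive w (f2.2 i).1 y0.
by apply: eq_bigr => j _; rewrite mxE.
Qed.

(** The double sum is the Hessian form of [f] at [x + G x] in the direction [v + G_v]; expanding it
    yields the first three terms on the right. At [x], all terms with [f_vv] or a [v]-derivative of
    the gradient vanish, and what remains pairs [G_vv] with the gradient, forming the gradient
    difference. *)
Lemma integrand_identity (R : realType) (n : nat) (f : 'rV[R]_n -> R)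
    (G : 'rV[R]_n -> 'rV[R]_n) (x v : 'rV[R]_n) :
  Ck 4 f -> convex_function (@orthant R n) f -> orthant x ->
  'D_v ('D_v f) x = 0 -> (forall i, Ck 2 (fun y => G y 0 i)) ->
  orthant (x + G x) ->
  (\sum_i ((0 + 'D_v ('D_v (fun y => G y 0 i)) x) * 'D_(delta_mx 0 i) f (x + G x) +
      (v 0 i + 'D_v (fun y => G y 0 i) x) *
        \sum_j (v 0 j + 'D_v (fun y => G y 0 j) x) *
          'D_(delta_mx 0 j) ('D_(delta_mx 0 i) f) (x + G x)))
    - 'D_v ('D_v f) x
    - \sum_i (
       ('D_v ('D_v (fun y => G y 0 i)) x * 'D_(delta_mx 0 i) f x +
        'D_v (fun y => G y 0 i) x * 'D_v ('D_(delta_mx 0 i) f) x) +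
       ('D_v (fun y => G y 0 i) x * 'D_v ('D_(delta_mx 0 i) f) x +
        G x 0 i * 'D_v ('D_v ('D_(delta_mx 0 i) f)) x)) =
  'D_v ('D_v f) (x + G x)
  + 2 * dotv ('D_v G x) (grad ('D_v f) (x + G x))
  + ('D_v G x *m hess f (x + G x) *m ('D_v G x)^T) 0 0
  + dotv ('D_v ('D_v G) x) (grad f (x + G x) - grad f x).
Proof.
move=> f4 cvxf x0 fvv0 G2 y0.
have f3 := CkW f4; have f2 := CkW f3.
set q := 'D_v G x; set y := x + G x in y0 *.
have qE i : 'D_v (fun y => G y 0 i) x = q 0 i by rewrite /q derive_coord.
set S := 'D_v ('D_v G) x.
have SE i : 'D_v ('D_v (fun y => G y 0 i)) x = S 0 i by rewrite /S derive2_coord.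
have null1 i : 'D_v ('D_(delta_mx 0 i) f) x = 0.
  apply: etrans (schwarz (delta_mx 0 i) v f2 x0) _.
  exact: convex_null_derive cvxf x0 fvv0 _ f2.
have null2 i : 'D_v ('D_v ('D_(delta_mx 0 i) f)) x = 0.
  exact: convex_null_derive2 cvxf x0 fvv0 _ f3.
have dvf1 : C1 ('D_v f) := (Ck_derive v f2).1.
have hessE := hess_form q f2 y0; have gradE := dotv_grad q dvf1 y0.
have quadE := derive2_add v q 1 f2 y0.
pose A := \sum_i S 0 i * 'D_(delta_mx 0 i) f y.
pose B := \sum_i S 0 i * 'D_(delta_mx 0 i) f x.
rewrite fvv0 subr0 hessE gradE.
have -> : \sum_i (('D_v ('D_v (fun y => G y 0 i)) x * 'D_(delta_mx 0 i) f x +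
        'D_v (fun y => G y 0 i) x * 'D_v ('D_(delta_mx 0 i) f) x) +
       ('D_v (fun y => G y 0 i) x * 'D_v ('D_(delta_mx 0 i) f) x +
        G x 0 i * 'D_v ('D_v ('D_(delta_mx 0 i) f)) x)) =
    B.
  by apply: eq_bigr => i _; rewrite null1 null2 SE !mulr0 !addr0.
have -> : \sum_i ((0 + 'D_v ('D_v (fun y => G y 0 i)) x) * 'D_(delta_mx 0 i) f y +
      (v 0 i + 'D_v (fun y => G y 0 i) x) *
        \sum_j (v 0 j + 'D_v (fun y => G y 0 j) x) *
          'D_(delta_mx 0 j) ('D_(delta_mx 0 i) f) y) =
    A + 'D_(v + 1 *: q) ('D_(v + 1 *: q) f) y.
  rewrite -(derive2_sum (v + 1 *: q) f2 y0) -big_split; apply: eq_bigr => i _ /=.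
  rewrite SE add0r qE; congr (_ + _ * _); first by rewrite !mxE mul1r.
  have [_ ->] := C1_derive (v + 1 *: q) (f2.2 i).1 y0.
  by apply: eq_bigr => j _; rewrite qE !mxE mul1r.
have -> : dotv S (grad f y - grad f x) = A - B.
  by rewrite /A /B /dotv -sumrB; apply: eq_bigr => i _; rewrite !mxE mulrBr.
apply: etrans (congr1 (fun c : R => A + c - B) quadE) _.
clearbody A B.
move: ('D_v ('D_v f) y) ('D_q ('D_v f) y) ('D_q ('D_q f) y) => X Y Z.
by ring.
Qed.

(** * Second derivative of the jump operator *)

(** The Leibniz rule is applied twice along the line. The first derivative is identified for all
    [|h| < r], which is what allows differentiating it again at 0. *)
Lemma derive2_integral (R : realType) (V : normedModType R) (J : V -> R)
    (x v : V) (c r : R) (g g1 g2 : R -> R -> R) :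
  0 < r -> derive_family r g g1 -> derive_family r g1 g2 ->
  (forall k : R, J (x + k *: v) = c * \int[lebesgue_measure]_(z in `[0, 1]) g k z) ->
  'D_v ('D_v J) x = c * \int[lebesgue_measure]_(z in `[0, 1]) g2 0 z.
Proof.
move=> r0 gg1 g12 JE.
have r00 : `|0 : R| < r by rewrite normr0.
have x00 : x + (0 : R) *: v = x by rewrite scale0r addr0.
pose I1 h := \int[lebesgue_measure]_(z in `[0, 1]) g1 h z.
have JE' : (fun k : R => J (x + k *: v)) =
    c *: (fun k => \int[lebesgue_measure]_(z in `[0, 1]) g k z).
  exact/funext.
have J1 h : `|h| < r -> 'D_v J (x + h *: v) = c * I1 h.
  move=> hr.
  have : is_derive h (1 : R) (fun k : R => J (x + k *: v)) (c * I1 h).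
    by rewrite JE'; exact: is_deriveZ (derive_integral gg1 hr).
  by move=> /is_derive_line[_ ->].
have J2 : is_derive (0 : R) (1 : R) (fun h : R => 'D_v J (x + h *: v))
    (c * \int[lebesgue_measure]_(z in `[0, 1]) g2 0 z).
  apply: (near_eq_is_derive (f := c *: I1)).
    by apply: filterS (near_family r00) => h hr; rewrite J1.
  exact: is_deriveZ (derive_integral g12 r00).
by have := (is_derive_line ('D_v J) x v 0 _).1 J2; rewrite x00 => -[_ ->].
Qed.

Lemma jump_op_derive2 (R : realType) (n : nat) (alpha T : R)
    (beta : 'rV[R]_n -> R -> 'M[R]_n) (lam : R -> R)
    (phi : 'rV[R]_n -> R -> R -> 'rV[R]_n) (x v : 'rV[R]_n) (t : R)
    (f : 'rV[R]_n -> R) :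
  0 < alpha -> model_assumptions alpha T beta lam phi ->
  orthant x -> 0 <= t <= T -> convex_test alpha f -> 'D_v ('D_v f) x = 0 ->
  'D_v ('D_v (fun y => jump_op lam phi f y t)) x =
  lam t * \int[lebesgue_measure]_(z in `[0, 1])
    (let p := phi x t z in
     let p_v := 'D_v (fun y => phi y t z) x in
     let p_vv := 'D_v ('D_v (fun y => phi y t z)) x in
     'D_v ('D_v f) (x + p)
     + 2 * dotv p_v (grad ('D_v f) (x + p))
     + (p_v *m hess f (x + p) *m p_v^T) 0 0
     + dotv p_vv (grad f (x + p) - grad f x)).
Proof.
move=> al0 model x0 tT [cvxf fh _] fvv0.
have f4 : Ck 4 f := C_holder_Ck al0 fh.
have x0h : orthant (2^-1 *: x) by move=> i; rewrite mxE mulr_gt0.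
have [r r0 rP] := @orthant_line_near R n x v v _ (near_box x0).
have line_box h : `|h| < r -> box (2^-1 *: x) (2 *: x) (x + h *: v).
  by move=> hr; have := rP h 0 (ltW hr); rewrite scale0r addr0 normr0; apply; exact: ltW.
have phi_Ck i z : 0 <= z <= 1 -> Ck 2 (fun y => phi y t z 0 i).
  by move=> z01; exact: C_holder_par_Ck al0 tT (phi_holder model i z01).
have phi_bound i : exists C : R, forall z, 0 <= z <= 1 ->
    forall s : seq 'I_n, (size s <= 2)%N ->
    forall y, box (2^-1 *: x) (2 *: x) y ->
    `|iter_partial s (fun y => phi y t z 0 i) y| <= C.
  (* On the compact set formed by the box and the single time [t], the Hoelder norms bounded
     uniformly in [z] give one constant for all jumps and all derivatives up to order two. *)
  have /(_ (box (2^-1 *: x) (2 *: x) `*` [set t])) := phi_holder_unif model i.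
  move=> [||C phiC].
  - by apply: compact_setX; [exact: box_compact|exact: compact_set1].
  - by move=> [y u] [/= /(box_orthant x0h) yo ->].
  exists C => z z01 s s2 y yb; have [phi_le _] := phiC z z01 s s2.
  exact: phi_le (y, t) (conj yb erefl).
have [gamma gamma1 phi_low] := phi_lower model.
have phi_low' y z i : orthant y -> 0 <= z <= 1 -> gamma * y 0 i < phi y t z 0 i.
  by move=> y0; exact: phi_low.
have phi_m y : orthant y -> forall O : set 'rV[R]_n, open O ->
    measurable ((`[0, 1]%classic : set (measurableTypeR R)) `&`
      (fun z => y + phi y t z) @^-1` O).
  by move=> y0 O; exact: measurable_slice_preimage (phi_measurable model) y0 tT.
have fam1 := integrand_family (phi := fun y z => phi y t z) x0 line_box
  phi_Ck phi_bound gamma1 phi_low' phi_m f4.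
have fam2 := integrand_derive_family (phi := fun y z => phi y t z) x0 line_box
  phi_Ck phi_bound gamma1 phi_low' phi_m f4.
pose J y := jump_op lam phi f y t.
(* This is mere unfolding of the operator and its gradient, hence valid for every [k], even where
   the line has left the orthant. *)
have JE k : J (x + k *: v) = lam t *
    \int[lebesgue_measure]_(z in `[0, 1])
      (f (x + k *: v + phi (x + k *: v) t z) - f (x + k *: v) -
       \sum_i phi (x + k *: v) t z 0 i * 'D_(delta_mx 0 i) f (x + k *: v)).
  congr (_ * _); apply: eq_Rintegral => z _.
  by congr (_ - _); apply: eq_bigr => i _; rewrite mxE.
apply: etrans (derive2_integral r0 fam1 fam2 JE) _.
have x00 : x + 0 *: v = x by rewrite scale0r addr0.
rewrite x00.
congr (_ * _); apply: eq_Rintegral => z; rewrite inE /= in_itv/= => z01.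
apply: (integrand_identity (G := fun y => phi y t z)) => //.
- by move=> i; exact: phi_Ck.
(* From [gamma > -1] one gets [phi_i > gamma x_i > - x_i], so the jump lands in the orthant. *)
- move=> i; rewrite mxE; have := phi_low' x z i x0 z01; have := x0 i.
  move: gamma1; move: (phi _ _ _ _ _) (x 0 i) => a b; nra.
Qed.

Unset Implicit Arguments.

Theorem theorem5p1 (R : realType) (n : nat) (n_gt0 : (0 < n)%N)
    (alpha T : R) (alpha01 : 0 < alpha < 1) (T_gt0 : 0 < T)
    (beta : 'rV[R]_n -> R -> 'M[R]_n) (lam : R -> R)
    (phi : 'rV[R]_n -> R -> R -> 'rV[R]_n)
    (model : model_assumptions alpha T beta lam phi)
    (x : 'rV[R]_n) (t : R) (x_in : orthant x) (t_in : 0 <= t <= T)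
    (lam_gt0 : 0 < lam t) :
  LCP alpha lam phi x t <->
  forall v : 'rV[R]_n, v != 0 ->
  forall f : 'rV[R]_n -> R, convex_test alpha f -> 'D_v ('D_v f) x = 0 ->
  0 <= \int[lebesgue_measure]_(z in `[0, 1])
    (let p := phi x t z in
     let p_v := 'D_v (fun y => phi y t z) x in
     let p_vv := 'D_v ('D_v (fun y => phi y t z)) x in
     'D_v ('D_v f) (x + p)
     + 2 * dotv p_v (grad ('D_v f) (x + p))
     + (p_v *m hess f (x + p) *m p_v^T) 0 0
     + dotv p_vv (grad f (x + p) - grad f x)).
Proof.
have [alpha_gt0 _] := andP alpha01.
split=> lcp v v0 f ftest fvv0; have := lcp v v0 f ftest fvv0.
  by rewrite (jump_op_derive2 alpha_gt0 model x_in t_in ftest fvv0) pmulr_rge0.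
by rewrite (jump_op_derive2 alpha_gt0 model x_in t_in ftest fvv0) pmulr_rge0.
Qed.
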